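(* Let $\theta=(\theta_1,\dots,\theta_d)\in\mathbb{R}^d$ be local coordinates on a differentiable manifold of stable linear dynamical systems, so that the transfer function matrix $H(z)=H(z;\theta)$ of the system is expressed as a function of $\theta$. Then the element $(i,j)$ of the Riemannian metric tensor $G$ of the system is $$g_{ij}=\frac{1}{2\pi \sqrt{-1}}\oint_{C}\mathrm{tr}\left[\frac{\partial H(z)}{\partial\theta_i}\,\frac{\partial H^{T}(z^{-1})}{\partial\theta_j}\right]z^{-1}\,dz,\qquad i,j=1,\dots,d,$$ where $C$ is the unit circle centered at the origin of the complex plane (traversed counterclockwise) and $\mathrm{tr}$ stands for trace.
   Context: A linear dynamical system $s$ is defined by its sequence $\{H_i\}_{i\ge 0}$ of real $m\times r$ Markov parameters ($r$ inputs, $m$ outputs), with transfer function $H(z)=\sum_{i\ge 0}H_i z^{-i}$, a matrix of rational functions of $z$ with real coefficients. It is stable if all poles of $H(z)$ lie in the open unit disc. Systems are points of the Hilbert space of such sequences with inner product $\langle s_1,s_2\rangle=\mathrm{tr}\big[\sum_{i=0}^{\infty}H_i^{(1)}(H_i^{(2)})^T\big]$. $H^T(z^{-1})$ denotes the transpose of $H$ evaluated at $z^{-1}$. The parametrization is assumed smooth: the coefficients of the rational entries of $H(z;\theta)$ depend smoothly on $\theta$. Tangent vectors at $s$ are derivatives of systems along smooth curves: if $\theta(v)$ is a curve through the coordinates of $s$, the tangent system $s'$ has Markov parameters $dH_i/dv$. The Riemannian metric tensor $G=(g_{ij})$ at $s$ is the symmetric $d\times d$ matrix such that, for any two curves $\theta(v_1),\theta(v_2)$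 through $s$ with coordinate derivatives $\theta_1',\theta_2'\in\mathbb{R}^d$ and corresponding tangent systems $s_1',s_2'$, one has $\theta_1'^{\,T}G\,\theta_2'=\langle s_1',s_2'\rangle$. *)

(* Defs.v *)
From HB Require Import structures.
From mathcomp Require Import all_boot all_order all_algebra.
From mathcomp Require Import complex.
From mathcomp Require Import all_classical all_reals all_analysis.

Set Implicit Arguments.
Unset Strict Implicit.
Unset Printing Implicit Defensive.

Import Order.TTheory GRing.Theory Num.Theory.
Import numFieldNormedType.Exports.

Local Open Scope classical_set_scope.
Local Open Scope ring_scope.
Local Open Scope complex_scope.

Section Smoothness.
Context {R : realType} {V W : normedModType R}.

Fixpoint Ck_on (n : nat) (A : set V) (f : V -> W) : Prop :=
  match n with
  | 0 => forall x, A x -> {for x, continuous f}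
  | k.+1 => (forall x, A x -> differentiable f x) /\
            (forall v, Ck_on k A (fun x => derive f x v))
  end.

Definition smooth_on (A : set V) (f : V -> W) : Prop := forall n, Ck_on n A f.

End Smoothness.

Section RationalFunctions.
Context {R : realType}.
Implicit Types (p q : {poly R}) (z : R[i]).

(* A rational function with real coefficients is given by a numerator p and a
   nonzero denominator q. *)
Definition rat_eval p q z : R[i] :=
  (map_poly (real_complex R) p).[z] / (map_poly (real_complex R) q).[z].

(* Zeros of the denominator after reduction to lowest terms. *)
Definition is_pole p q z : bool :=
  root (map_poly (real_complex R) (q %/ gcdp p q)) z.

Definition common_zero p q z : bool :=
  root (map_poly (real_complex R) p) z && root (map_poly (real_complex R) q) z.

End RationalFunctions.

Section Systems.
Context {R : realType} {m r : nat}.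
Implicit Types (s : nat -> 'M[R]_(m, r)) (N D : 'M[{poly R}]_(m, r)).

(* The matrix with entries N a b / D a b, evaluated at z. *)
Definition tf_eval N D (z : R[i]) : 'M[R[i]]_(m, r) :=
  \matrix_(a, b) rat_eval (N a b) (D a b) z.

(* H(z) = \sum_k s_k z^-k in a neighbourhood of infinity. *)
Definition is_transfer_function s N D : Prop :=
  (forall a b, D a b != 0) /\
  exists rho : R, forall (z : R[i]) a b, rho%:C < `|z| ->
    (series (fun k => (s k a b)%:C * z ^- k) : nat -> R[i]^o) @ \oo
      --> (tf_eval N D z a b : R[i]^o).

Definition stable N D : Prop :=
  forall a b z, is_pole (N a b) (D a b) z -> `|z| < 1.

Definition square_summable s : Prop :=
  cvgn (series (fun k => \tr (s k *m (s k)^T))).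

Definition sys_inner s1 s2 : R :=
  \tr (limn (series (fun k => s1 k *m (s2 k)^T))).

End Systems.

Section Families.
Context {R : realType} {d m r : nat}.
Implicit Types (U : set 'rV[R]_d) (h : 'rV[R]_d -> nat -> 'M[R]_(m, r))
  (N D : 'rV[R]_d -> 'M[{poly R}]_(m, r)) (theta : 'rV[R]_d) (c : R -> 'rV[R]_d).

(* The entries of N theta and D theta have boundedly many coefficients, which
   are smooth functions of theta.  The fractions need not be in lowest terms,
   so that (z - x) / (z - y) is allowed at x = y, but nothing may cancel at a
   point of |z| >= 1: with N = x and D = z - (1 - x^2), every system with
   |x| < 1 is stable, yet the derivative at x = 0 is 1 / (z - 1), which is not
   square summable. *)
Definition smooth_coefficients U N D : Prop :=
  [/\ exists n, forall theta a b, U theta ->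
        (size (N theta a b) <= n)%N /\ (size (D theta a b) <= n)%N,
      forall a b k, smooth_on U (fun theta => (N theta a b)`_k),
      forall a b k, smooth_on U (fun theta => (D theta a b)`_k) &
      forall theta a b z, U theta ->
        common_zero (N theta a b) (D theta a b) z -> `|z| < 1].

(* theta in U are local coordinates of the stable system h theta, whose
   transfer function is N theta / D theta. *)
Definition local_coordinates U h N D : Prop :=
  [/\ open U,
      set_inj U h,
      forall theta, U theta ->
        is_transfer_function (h theta) (N theta) (D theta),
      forall theta, U theta -> stable (N theta) (D theta) &
      smooth_coefficients U N D].

Definition smooth_curve_through U theta c (v : R) : Prop :=
  c v = theta /\
  exists2 e : R, 0 < e &
    smooth_on (V := R^o) (ball v e) c /\ (forall t, ball v e t -> U (c t)).

Definition tangent_system h c (v : R) : nat -> 'M[R]_(m, r) :=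
  fun k => derive1 (fun t => h (c t) k) v.

Definition is_metric_tensor U h theta (G : 'M[R]_d) : Prop :=
  G^T = G /\
  forall c1 v1 c2 v2,
    smooth_curve_through U theta c1 v1 -> smooth_curve_through U theta c2 v2 ->
    [/\ square_summable (tangent_system h c1 v1),
        square_summable (tangent_system h c2 v2) &
        (derive1 c1 v1 *m G *m (derive1 c2 v2)^T) 0 0 =
          sys_inner (tangent_system h c1 v1) (tangent_system h c2 v2)].

(* 'D_v of the library needs a codomain normed over R; R[i] is normed over
   itself, hence the split into real and imaginary parts. *)
Definition partial {p q : nat} (i : 'I_d) (F : 'rV[R]_d -> 'M[R[i]]_(p, q))
    theta : 'M[R[i]]_(p, q) :=
  \matrix_(a, b)
    (derive (fun t => complex.Re (F t a b)) theta (delta_mx 0 i) +i*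
     derive (fun t => complex.Im (F t a b)) theta (delta_mx 0 i)).

End Families.

Section Contour.
Context {R : realType}.

(* Integral over the unit circle, counterclockwise: z = e^(it), dz = i z dt. *)
Definition circle_integral (f : R[i] -> R[i]) : R[i] :=
  let g (t : R) := let z := cos t +i* sin t in f z * ('i%C * z) in
  Rintegral (@lebesgue_measure R) `[0, 2 * pi] (fun t => complex.Re (g t)) +i*
  Rintegral (@lebesgue_measure R) `[0, 2 * pi] (fun t => complex.Im (g t)).

End Contour.

(* Main.v *)
Require Import Defs.
From HB Require Import structures.
From mathcomp Require Import all_boot all_order all_algebra.
From mathcomp Require Import complex.
From mathcomp Require Import all_classical all_reals all_analysis measurable_realfun.
From mathcomp Require Import ring lra zify.
Set Implicit Arguments.
Unset Strict Implicit.
Unset Printing Implicit Defensive.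
Import Order.TTheory GRing.Theory Num.Theory.
Import numFieldNormedType.Exports.
Local Open Scope classical_set_scope.
Local Open Scope ring_scope.
Local Open Scope complex_scope.

(** The Gram matrix of the coordinate tangent systems is the only candidate
    for the metric tensor.  Write h_k(theta) for the Markov parameters and
    d_i h for the sequence of their partial derivatives.  By the chain rule
    the tangent system of a curve c is the combination of the d_i h with the
    coordinates of c' as coefficients, so the matrix of the inner products
    of the d_i h satisfies the defining identity, and testing the identity
    on the coordinate lines shows that nothing else does ([coord_metricP],
    [metric_tensor_unique]).  The contour formula is then Parseval's identity:
    if A(z) = sum a_k z^-k and B(1/z) = sum b_k z^k on the unit circle, then
    integrating A(z) B(1/z) / z keeps only the diagonal terms and leaves
    2 pi i sum a_k b_k ([circle_integral_parseval]).

    What has to be proved is that the d_i h are summable enough and that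
    sum (d_i h)_k z^-k is the partial derivative of the transfer function at
    each z of the unit circle ([pow_sum_partial]).  No termwise
    differentiation of series is used.  With w = 1/z, an entry p(z)/q(z) of
    the transfer function is a quotient P(w)/Q(w) of reversed polynomials,
    and comparing coefficients turns the expansion at infinity into the
    linear recursion Q * h = P between coefficient sequences
    ([markov_convolution]).  Near theta the degree of q does not change,
    because its roots stay in the unit disc, which bounds all its
    coefficients by a multiple of the leading one ([near_size_q]).  Hence the
    leading coefficient can be divided by, every h_k is differentiable, and
    differentiating the recursion gives
    Q * d h = d P - d Q * h ([dmarkov_convolution]).

    Since all roots of q lie in the open disc, Q factors into terms 1 - r w
    with |r| < 1, and dividing by such a term preserves absolute summability
    ([ell1_div_linear]).  So h and d h are absolutely summable, their sums at
    |w| = 1 exist, and evaluating the two recursions there gives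
    Q H = P and Q X = d P - d Q H for H = P/Q and the sum X of d h: this is
    the quotient rule, so X is the derivative of p/q. *)

(** * Convolution of a polynomial with a sequence *)

Section Convolution.
Context {K : comNzRingType}.
Implicit Types (P Q : {poly K}) (u v : nat -> K).

(** [P] acts on sequences as a polynomial in the one-step delay, that is, by
    multiplication of generating series. *)
Definition conv P u (k : nat) : K := \sum_(j < k.+1) P`_j * u (k - j)%N.

(** Only the first terms of u matter for a given coefficient, so facts on
    convolutions reduce to facts on products of polynomials. *)
Lemma conv_coefM P u M k : (k < M)%N -> conv P u k = (P * \poly_(i < M) u i)`_k.
Proof.
move=> kM; rewrite coefM; apply: eq_bigr => j _.
by rewrite coef_poly (leq_ltn_trans (leq_subr _ _) kM).
Qed.

Lemma convM P Q u : conv (P * Q) u =1 conv P (conv Q u).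
Proof.
move=> k; rewrite (conv_coefM _ _ (ltnSn k)) -mulrA coefM.
apply: eq_bigr => j _; congr (_ * _).
by rewrite -conv_coefM // ltnS leq_subr.
Qed.

Lemma convDl P Q u k : conv (P + Q) u k = conv P u k + conv Q u k.
Proof.
by rewrite /conv -big_split; apply: eq_bigr => j _; rewrite coefD mulrDl.
Qed.

Lemma convC c u k : conv c%:P u k = c * u k.
Proof.
rewrite /conv big_ord_recl subn0 coefC /= big1 ?addr0 // => j _.
by rewrite coefC /= mul0r.
Qed.

Definition delay u (k : nat) : K := if k is k'.+1 then u k' else 0.

Lemma convX u : conv 'X u =1 delay u.
Proof.
case=> [|k]; rewrite /conv big_ord_recl coefX mul0r add0r; first by rewrite big_ord0.
rewrite big_ord_recl coefX /= /bump /= mul1r subn1 /= big1 ?addr0 // => j _.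
by rewrite coefX /= mul0r.
Qed.

Lemma convMX P u : conv (P * 'X) u =1 delay (conv P u).
Proof. by move=> k; rewrite mulrC convM convX. Qed.

Lemma convXn P n u k :
  conv ('X^n * P) u k = if (n <= k)%N then conv P u (k - n) else 0.
Proof.
elim: n k => [|n IH] k; first by rewrite expr0 mul1r subn0.
by rewrite exprS -mulrA mulrC convMX; case: k => [|k] //=; rewrite IH.
Qed.

(** The unit of convolution; it turns statements on [conv P u] into
    statements on the coefficients of [P]. *)
Definition unit_impulse (k : nat) : K := (k == 0%N)%:R.

Lemma conv_impulse P k : conv P unit_impulse k = P`_k.
Proof.
rewrite /conv (bigD1 ord_max) //= subnn mulr1 big1 ?addr0 // => j jk.
rewrite /unit_impulse subn_eq0 leqNgt; have jk' : (j < k)%N.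
  by rewrite ltn_neqAle -ltnS ltn_ord andbT; apply: contra jk => /eqP jk; apply/eqP/val_inj.
by rewrite jk' mulr0.
Qed.

(** For [size P <= n.+1] this is w^n P(1/w).  The degree [n] is explicit so
    that polynomials depending on a parameter are all reversed at the same
    degree. *)
Definition recip n P : {poly K} := \poly_(j < n.+1) P`_(n - j).

Lemma coef_recip n P k : (recip n P)`_k = if (k <= n)%N then P`_(n - k) else 0.
Proof. by rewrite coef_poly ltnS. Qed.

Lemma recip_widen m n P : (m <= n)%N -> (size P <= m.+1)%N ->
  recip n P = 'X^(n - m) * recip m P.
Proof.
move=> mn sP; apply/polyP => k; rewrite coefXnM !coef_recip.
case: ltnP => knm; case: (leqP k n) => kn //.
- apply: nth_default; apply: leq_trans sP _; lia.
- have -> : (k - (n - m) <= m)%N by lia.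
  by congr (_`_ _); lia.
- by have -> : (k - (n - m) <= m)%N = false by lia.
Qed.

Lemma recip_MXsubC n P r : (size P <= n.+1)%N ->
  recip n.+1 (('X - r%:P) * P) = (1 - r%:P * 'X) * recip n P.
Proof.
move=> sP; apply/polyP => k.
rewrite coef_recip !mulrBl mul1r -mulrA !coefB !coefCM !coefXM !coef_recip.
case: k => [|k] /=.
  by rewrite !subn0 (nth_default _ sP) mulr0 subr0.
rewrite subSS; case: (ltngtP k n) => kn.
- have -> : (k < n.+1)%N by lia.
  have -> : (n - k == 0)%N = false by lia.
  by congr (_`_ _ - _); lia.
- have -> : (k < n.+1)%N = false by lia.
  by rewrite mulr0 subr0.
- by rewrite kn ltnSn subnn eqxx.
Qed.

End Convolution.

Lemma horner_recip (K : fieldType) n (P : {poly K}) z : (size P <= n.+1)%N -> z != 0 ->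
  (recip n P).[z^-1] = P.[z] / z ^+ n.
Proof.
move=> sP z0; rewrite (horner_coef_wide _ (size_poly _ _)) (horner_coef_wide _ sP).
rewrite mulr_suml [RHS](reindex_inj rev_ord_inj) /=; apply: eq_bigr => j _.
rewrite coef_recip -ltnS ltn_ord subSS -mulrA; congr (_ * _).
have jn : (j <= n)%N by rewrite -ltnS.
by rewrite exprVn -[X in _ / z ^+ X](subnK jn) exprD invfM mulrA mulfV ?expf_neq0 // mul1r.
Qed.

Lemma map_recip (K L : comNzRingType) (f : {rmorphism K -> L}) n (P : {poly K}) :
  map_poly f (recip n P) = recip n (map_poly f P).
Proof.
apply/polyP => k; rewrite coef_map !coef_recip; case: (k <= n)%N; first by rewrite coef_map.
exact: rmorph0.
Qed.

Lemma map_conv (K L : comNzRingType) (f : {rmorphism K -> L}) (P : {poly K}) u k :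
  f (conv P u k) = conv (map_poly f P) (fun j => f (u j)) k.
Proof.
by rewrite rmorph_sum; apply: eq_bigr => j _; rewrite rmorphM coef_map.
Qed.

Section Summability.
Context {K : numFieldType}.
Implicit Types (P : {poly K}) (u v : nat -> K).

(** Bounded partial sums rather than a convergent series: the notion makes
    sense, and is stable by the operations below, without completeness, in
    particular over R[i]. *)
Definition ell1 u := exists M, forall n, \sum_(k < n) `|u k| <= M.

Lemma eq_ell1 u v : u =1 v -> ell1 u -> ell1 v.
Proof.
move=> uv [M uM]; exists M => n.
by under eq_bigr do rewrite -uv.
Qed.

Lemma ell1D u v : ell1 u -> ell1 v -> ell1 (fun k => u k + v k).
Proof.
move=> [M uM] [N vN]; exists (M + N) => n.
apply: le_trans (lerD (uM n) (vN n)); rewrite -big_split /=.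
by apply: ler_sum => k _; exact: ler_normD.
Qed.

Lemma ell1Z c u : ell1 u -> ell1 (fun k => c * u k).
Proof.
move=> [M uM]; exists (`|c| * M) => n.
under eq_bigr do rewrite normrM.
by rewrite -mulr_sumr ler_wpM2l.
Qed.

Lemma ell1_delay u : ell1 u -> ell1 (delay u).
Proof.
move=> [M uM]; exists M => -[|n]; first by have := uM 0%N; rewrite !big_ord0.
by rewrite big_ord_recl normr0 add0r; exact: uM.
Qed.

Lemma ell1_conv P u : ell1 u -> ell1 (conv P u).
Proof.
move=> u1; elim/poly_ind: P => [|P c IH].
  exists 0 => n; rewrite big1 // => k _.
  by rewrite /conv big1 ?normr0 // => j _; rewrite coef0 mul0r.
apply: (eq_ell1 (u := fun k => delay (conv P u) k + c * u k)).
  by move=> k; rewrite convDl convMX convC.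
by apply: ell1D; [exact: ell1_delay | exact: ell1Z].
Qed.

Lemma ell1_impulse : ell1 unit_impulse.
Proof.
exists 1 => -[|n]; first by rewrite big_ord0.
rewrite big_ord_recl big1 ?addr0 ?normr1 // => k _.
by rewrite /unit_impulse normr0.
Qed.

Lemma ell1_coef P : ell1 (fun k => P`_k).
Proof. by apply: eq_ell1 (ell1_conv P ell1_impulse) => k; rewrite conv_impulse. Qed.

(** If f = (1 - r w) v then v_k = r v_{k-1} + f_k, so the partial sums satisfy
    sum |v| <= |r| sum |v| + sum |f|. *)
Lemma ell1_div_linear r v : `|r| < 1 -> ell1 (conv (1 - r%:P * 'X) v) -> ell1 v.
Proof.
move=> r1 [M fM]; exists (M / (1 - `|r|)) => n.
rewrite ler_pdivlMr ?subr_gt0 // mulrBr mulr1 lerBlDr.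
apply: (@le_trans _ _ (M + `|r| * \sum_(k < n) `|delay v k|)).
  apply: le_trans (lerD (fM n) (lexx _)).
  rewrite mulr_sumr -big_split; apply: ler_sum => k _ /=.
  rewrite -normrM; apply: le_trans (ler_normD _ _).
  have -> : conv (1 - r%:P * 'X) v k = v k - r * delay v k.
    by rewrite -mulNr -polyCN convDl -polyC1 convC mul1r convM convC (convX v k) mulNr.
  by rewrite subrK.
rewrite lerD2l mulrC ler_wpM2r // .
case: n => [|n]; first by rewrite !big_ord0.
rewrite big_ord_recl normr0 add0r [leRHS]big_ord_recr /=.
by rewrite lerDl.
Qed.

End Summability.

(** * Polynomials with all roots in the open unit disc *)

Section DiscRoots.
Context {K : numClosedFieldType}.
Implicit Types (P : {poly K}) (u v : nat -> K) (s : seq K).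

Lemma ell1_div_prod s u : (forall z, z \in s -> `|z| < 1) ->
  ell1 (conv (recip (size s) (\prod_(z <- s) ('X - z%:P))) u) -> ell1 u.
Proof.
elim: s u => [|z s IH] u sd /=.
  rewrite big_nil; apply: eq_ell1 => k.
  have -> : recip 0 (1 : {poly K}) = 1%:P.
    by apply/polyP => j; rewrite coef_recip leqn0 sub0n coef1 coefC; case: eqP.
  by rewrite convC mul1r.
rewrite big_cons recip_MXsubC ?size_prod_XsubC // => h.
apply: IH => [x xs|]; first by apply: sd; rewrite inE xs orbT.
apply: (@ell1_div_linear _ z); first by apply: sd; rewrite inE eqxx.
by apply: eq_ell1 h; exact: convM.
Qed.

(** The reversed polynomial is the leading coefficient times the product of
    the factors 1 - z w over the roots z of [P].  The exact size matters: at a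
    larger [n], [recip n P] would be divisible by w. *)
Lemma ell1_div P n u : size P = n.+1 -> (forall z, root P z -> `|z| < 1) ->
  ell1 (conv (recip n P) u) -> ell1 u.
Proof.
move=> sP Pd; have [s Ps] := closed_field_poly_normal P.
have P0 : lead_coef P != 0 by rewrite lead_coef_eq0 -size_poly_eq0 sP.
have ss : size s = n.
  by apply: succn_inj; rewrite -sP Ps size_scale // size_prod_XsubC.
move=> h; apply: (@ell1_div_prod s).
  by move=> z zs; apply: Pd; rewrite Ps rootZ // root_prod_XsubC.
rewrite ss; apply: eq_ell1 (ell1Z (lead_coef P)^-1 h) => k.
rewrite {2}Ps /conv mulr_sumr; apply: eq_bigr => j _.
by rewrite !coef_recip; case: ifP; rewrite ?mul0r ?mulr0 // coefZ -!mulrA mulKf.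
Qed.

(** The coefficients are the elementary symmetric functions of the roots;
    2 to the number of roots bounds the sum of their absolute values. *)
Lemma coef_prod_XsubC_le s j : (forall z, z \in s -> `|z| < 1) ->
  `|(\prod_(z <- s) ('X - z%:P))`_j| <= 2 ^+ size s.
Proof.
elim: s j => [|z s IH] j sd /=.
  by rewrite big_nil coef1; case: (j == 0)%N; rewrite ?normr1 ?normr0.
have {}IH k : `|(\prod_(z <- s) ('X - z%:P))`_k| <= 2 ^+ size s.
  by apply: IH => x xs; apply: sd; rewrite inE xs orbT.
have z1 : `|z| <= 1 by apply/ltW/sd; rewrite inE eqxx.
rewrite big_cons mulrBl coefB coefXM coefCM exprS mulr_natl mulr2n.
apply: le_trans (ler_normB _ _) (lerD _ _).
  by case: ifP => _; rewrite ?normr0 ?exprn_ge0.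
by rewrite normrM -[leRHS]mul1r ler_pM.
Qed.

Lemma coef_le_lead P j : (forall z, root P z -> `|z| < 1) ->
  `|P`_j| <= 2 ^+ (size P).-1 * `|lead_coef P|.
Proof.
move=> Pd; have [->|P0] := eqVneq P 0; first by rewrite coef0 lead_coef0 normr0 mulr0.
have [s Ps] := closed_field_poly_normal P.
have l0 : lead_coef P != 0 by rewrite lead_coef_eq0.
have -> : (size P).-1 = size s by rewrite Ps size_scale // size_prod_XsubC.
rewrite {1}Ps coefZ normrM mulrC ler_wpM2r // coef_prod_XsubC_le // => z zs.
by apply: Pd; rewrite Ps rootZ // root_prod_XsubC.
Qed.

End DiscRoots.

Section RealPoly.
Context {R : realType}.
Implicit Types (p q : {poly R}) (u : nat -> R).

Lemma normC_real (x : R) : `|x%:C| = `|x|%:C.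
Proof. by rewrite normc_def /= expr0n /= addr0 sqrtr_sqr. Qed.

Lemma ell1_realC u : ell1 u <-> ell1 (fun k => (u k)%:C).
Proof.
have e n : \sum_(k < n) `|(u k)%:C| = (\sum_(k < n) `|u k|)%:C.
  by rewrite rmorph_sum; apply: eq_bigr => k _; exact: normC_real.
split=> -[M uM].
  by exists M%:C => n; rewrite e lecR.
by exists (complex.Re M) => n; have := uM n; rewrite e lecE => /andP[].
Qed.

Lemma ell1_div_real p n u : size p = n.+1 ->
  (forall z, root (map_poly (real_complex R) p) z -> `|z| < 1) ->
  ell1 (conv (recip n p) u) -> ell1 u.
Proof.
move=> sp pd h; apply/ell1_realC; apply: (@ell1_div _ (map_poly (real_complex R) p) n).
- by rewrite size_map_poly.
- exact: pd.
- move/ell1_realC: h; apply: eq_ell1 => k.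
  by rewrite (map_conv (real_complex R)) map_recip.
Qed.

Lemma coef_le_lead_real p j :
  (forall z, root (map_poly (real_complex R) p) z -> `|z| < 1) ->
  `|p`_j| <= 2 ^+ (size p).-1 * `|lead_coef p|.
Proof.
move=> pd; have := coef_le_lead j pd.
rewrite coef_map size_map_poly lead_coef_map !normC_real -lecR rmorphM rmorphXn.
by rewrite rmorph_nat.
Qed.

End RealPoly.

(** * Sums and uniqueness of power series *)

Section PowerSeries.
Context {K : numFieldType}.
Implicit Types (P : {poly K}) (u v : nat -> K).

(** K^o carries the topology of K as a normed module over itself, which the
    lemmas on series expect. *)
Definition pow_sum u (w U : K) : Prop :=
  (series (fun k => u k * w ^+ k) : nat -> K^o) @ \oo --> (U : K^o).

Lemma eq_pow_sum u v w U : u =1 v -> pow_sum u w U -> pow_sum v w U.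
Proof. by move=> /funext ->. Qed.

Lemma pow_sum_unique u w U V : pow_sum u w U -> pow_sum u w V -> U = V.
Proof. by move=> hU hV; exact: (cvg_unique _ hU hV). Qed.

Lemma pow_sumD u v w U V : pow_sum u w U -> pow_sum v w V ->
  pow_sum (fun k => u k + v k) w (U + V).
Proof.
move=> hU hV; rewrite /pow_sum.
have -> : series (fun k => (u k + v k) * w ^+ k) =
    (series (fun k => u k * w ^+ k) : nat -> K^o) \+ series (fun k => v k * w ^+ k).
  apply/funext => n; rewrite /series /= -big_split; apply: eq_bigr => k _.
  exact: mulrDl.
exact: cvgD.
Qed.

Lemma pow_sumZ c u w U : pow_sum u w U -> pow_sum (fun k => c * u k) w (c * U).
Proof.
move=> hU; rewrite /pow_sum.
have -> : series (fun k => c * u k * w ^+ k) =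
    (fun n => c * series (fun k => u k * w ^+ k) n).
  apply/funext => n; rewrite /series /= mulr_sumr.
  by apply: eq_bigr => k _; rewrite mulrA.
exact: cvgMl_tmp.
Qed.

Lemma pow_sum_delay u w U : pow_sum u w U -> pow_sum (delay u) w (w * U).
Proof.
move=> hU; rewrite /pow_sum -cvg_shiftS.
have -> : [sequence series (fun k => delay u k * w ^+ k) n.+1]_n =
    (fun n => w * series (fun k => u k * w ^+ k) n).
  apply/funext => n.
  rewrite /= !seriesEord /= big_ord_recl mul0r add0r mulr_sumr.
  by apply: eq_bigr => k _; rewrite exprS mulrCA.
exact: cvgMl_tmp.
Qed.

(** Multiplying by w delays the sequence by one step, so the polynomial can
    be built up by Horner's scheme; absolute convergence is not needed. *)
Lemma pow_sum_conv P u w U : pow_sum u w U -> pow_sum (conv P u) w (P.[w] * U).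
Proof.
move=> hU; elim/poly_ind: P => [|P c IH].
  have := @pow_sumZ 0 _ _ _ hU; rewrite horner0 !mul0r; apply: eq_pow_sum => k.
  by rewrite mul0r -polyC0 convC mul0r.
rewrite hornerD hornerMX hornerC mulrDl.
apply: (@eq_pow_sum (fun k => delay (conv P u) k + c * u k)).
  by move=> k; rewrite convDl convMX convC.
apply: pow_sumD; last exact: pow_sumZ.
by rewrite [_ * w]mulrC -mulrA; exact: pow_sum_delay.
Qed.

Lemma pow_sum_impulse w : pow_sum unit_impulse w 1.
Proof.
rewrite /pow_sum -cvg_shiftS.
have -> : [sequence series (fun k => unit_impulse k * w ^+ k) n.+1]_n = cst 1.
  apply/funext => n; rewrite /= seriesEord /= big_ord_recl big1 => [|k _].
    by rewrite addr0 mulr1.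
  by rewrite /unit_impulse /= mul0r.
exact: cvg_cst.
Qed.

Lemma pow_sum_coef P w : pow_sum (fun k => P`_k) w P.[w].
Proof.
rewrite -[P.[w]]mulr1; apply: eq_pow_sum (@pow_sum_conv P _ _ _ (@pow_sum_impulse w)) => k.
exact: conv_impulse.
Qed.

End PowerSeries.

Section Uniqueness.
Context {R : realType}.
Implicit Types (e u : nat -> R) (p q : {poly R}).

Lemma sum_expr_le2 (s : R) n : 0 <= s -> s <= 2^-1 -> \sum_(k < n) s ^+ k <= 2.
Proof.
move=> s0 s1; elim: n => [|n IH]; first by rewrite big_ord0.
rewrite big_ord_recl expr0 /=.
have -> : \sum_(i < n) s ^+ bump 0 i = s * \sum_(i < n) s ^+ i.
  by rewrite mulr_sumr; apply: eq_bigr => i _; rewrite exprS.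
have : s * \sum_(i < n) s ^+ i <= 2^-1 * 2.
  by apply: ler_pM => //; apply: sumr_ge0 => i _; rewrite exprn_ge0.
lra.
Qed.

(** The terms at [w0] are bounded by some [M], so at [w0 * s] the tail beyond the
    first term is at most 2 M s, and [s] can be taken arbitrarily small. *)
Lemma pow_sum0_head e delta : 0 < delta ->
  (forall w, 0 < w < delta -> pow_sum e w 0) -> e 0%N = 0.
Proof.
move=> d0 he; pose w0 := delta / 2.
have w00 : 0 < w0 by rewrite /w0; lra.
have cv : cvgn (series (fun k => e k * w0 ^+ k)).
  by apply/cvg_ex; exists 0; apply: he; rewrite w00 /= /w0; lra.
have /pinfty_ex_gt0 [M M0 /= hM] := cvg_series_bounded cv.
apply/eqP; rewrite -normr_le0; apply/ler_addgt0Pr => eps eps0; rewrite add0r.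
(* This makes the tail bound 2 M s at most eps / 2. *)
pose s := Num.min 2^-1 (eps / (4 * M)).
have s0 : 0 < s by rewrite lt_min invr_gt0 ltr0n /= divr_gt0 // mulr_gt0.
have s1 : s <= 2^-1 by rewrite ge_min lexx.
have sM : 2 * M * s <= eps / 2.
  have : s <= eps / (4 * M) by rewrite ge_min lexx orbT.
  by rewrite ler_pdivlMr ?mulr_gt0 //; lra.
have ws : 0 < w0 * s < delta.
  rewrite mulr_gt0 //=.
  have : w0 * s <= w0 * 2^-1 by rewrite ler_pM2l.
  by rewrite {2}/w0; lra.
have e20 : 0 < eps / 2 by lra.
have /(cvgr0_norm_lt) /(_ _ e20) [N _ hN] := he _ ws.
have := hN N.+1 (leqnSn N); rewrite seriesEord /= big_ord_recl mulr1 => hlt.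
set T := \sum_(i < N) _ in hlt.
have TM : `|T| <= 2 * M * s.
  apply: le_trans (ler_norm_sum _ _ _) _.
  apply: (@le_trans _ _ (\sum_(i < N) M * s * s ^+ i)).
    apply: ler_sum => i _; rewrite exprMn mulrA normrM.
    rewrite (ger0_norm (exprn_ge0 _ (ltW s0))) [s ^+ lift _ _]exprS -[leRHS]mulrA.
    by apply: ler_wpM2r; [rewrite mulr_ge0 ?exprn_ge0 ?(ltW s0) | exact: hM].
  rewrite -mulr_sumr.
  have := sum_expr_le2 N (ltW s0) s1 => hs.
  have := ler_wpM2l (ltW (mulr_gt0 M0 s0)) hs; lra.
have : `|e 0%N| <= `|e 0%N + T| + `|T|.
  by rewrite -{1}[e 0%N](addrK T); exact: ler_normB.
lra.
Qed.

Lemma pow_sum0 e delta : 0 < delta ->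
  (forall w, 0 < w < delta -> pow_sum e w 0) -> forall k, e k = 0.
Proof.
move=> d0 he k; elim: k e he => [|k IH] e he; first exact: pow_sum0_head d0 he.
(* The head vanishes, so the shifted sequence also sums to 0. *)
apply: (IH (fun k => e k.+1)) => w wd; have := he w wd.
have w0 : w != 0 by rewrite gt_eqF; case/andP: wd.
rewrite /pow_sum -cvg_shiftS => /(@cvgMl_tmp _ _ _ _ _ w^-1); rewrite mulr0.
suff -> : (fun x => w^-1 * [sequence series (fun k0 => e k0 * w ^+ k0) n.+1]_n x) =
   series (fun k0 => e k0.+1 * w ^+ k0) by [].
apply/funext => n; rewrite /= !seriesEord /= big_ord_recl (pow_sum0_head d0 he) mul0r add0r.
rewrite mulr_sumr; apply: eq_bigr => i _.
by rewrite exprS mulrCA mulKf.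
Qed.

End Uniqueness.

(** * From the expansion at infinity to a linear recursion *)

Section ComplexLimits.
Context {R : realType}.
Implicit Types (f : nat -> R[i]) (z l : R[i]).

Lemma normc_ge_Im z : `|complex.Im z|%:C <= `|z|.
Proof.
have := normc_ge_Re (z * 'i%C); rewrite ReiNIm normrN normrM.
by rewrite [`|'i%C|]normc_def /= expr0n expr1n add0r sqrtr1 mulr1.
Qed.

Lemma normc_le_ReIm z : `|z| <= (`|complex.Re z| + `|complex.Im z|)%:C.
Proof.
rewrite {1}(complexE z) rmorphD; apply: le_trans (ler_normD _ _) _.
rewrite normrM [`|'i%C|]normc_def /= expr0n expr1n add0r sqrtr1 mul1r.
by rewrite !normC_real.
Qed.

Lemma cvg_Re f l : (f : nat -> R[i]^o) @ \oo --> (l : R[i]^o) ->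
  (fun n => complex.Re (f n)) @ \oo --> complex.Re l.
Proof.
move=> /cvgrPdist_lt h; apply/cvgrPdist_lt => e e0.
have e0' : 0 < e%:C by rewrite ltcR.
near=> n.
rewrite -ltcR -(raddfB (@complex.Re R : Rcomplex R -> R)).
apply: le_lt_trans (normc_ge_Re _) _.
by near: n; exact: h.
Unshelve. all: by end_near. Qed.

Lemma cvg_Im f l : (f : nat -> R[i]^o) @ \oo --> (l : R[i]^o) ->
  (fun n => complex.Im (f n)) @ \oo --> complex.Im l.
Proof.
move=> /cvgrPdist_lt h; apply/cvgrPdist_lt => e e0.
have e0' : 0 < e%:C by rewrite ltcR.
near=> n.
rewrite -ltcR -(raddfB (@complex.Im R : Rcomplex R -> R)).
apply: le_lt_trans (normc_ge_Im _) _.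
by near: n; exact: h.
Unshelve. all: by end_near. Qed.

Lemma cvg_ReIm f l : (fun n => complex.Re (f n)) @ \oo --> complex.Re l ->
  (fun n => complex.Im (f n)) @ \oo --> complex.Im l ->
  (f : nat -> R[i]^o) @ \oo --> (l : R[i]^o).
Proof.
move=> /cvgrPdist_lt hr /cvgrPdist_lt hi; apply/cvgrPdist_lt => e e0.
have [er ei] : 0 < complex.Re e /\ complex.Im e = 0.
  by move: e0; rewrite ltcE => /andP[/eqP -> ->].
have eE : e = (complex.Re e)%:C by rewrite {1}(complexE e) ei rmorph0 mulr0 addr0.
have e20 : 0 < complex.Re e / 2 by lra.
near=> n.
rewrite eE; apply: le_lt_trans (normc_le_ReIm _) _; rewrite ltcR.
rewrite (raddfB (@complex.Re R : Rcomplex R -> R)) (raddfB (@complex.Im R : Rcomplex R -> R)).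
rewrite [ltRHS]splitr ltrD //.
  by near: n; exact: hr.
by near: n; exact: hi.
Unshelve. all: by end_near. Qed.

End ComplexLimits.

Section MarkovParameters.
Context {R : realType}.
Implicit Types (p q : {poly R}) (g : nat -> R).

(** Stability and the absence of cancellations outside the disc combine into
    this condition on the unreduced denominator. *)
Definition disc_roots q := forall z, root (map_poly (real_complex R) q) z -> `|z| < 1.

Definition expansion g p q := exists rho : R, forall z : R[i], rho%:C < `|z| ->
  (series (fun k => (g k)%:C * z ^- k) : nat -> R[i]^o) @ \oo --> (rat_eval p q z : R[i]^o).

Lemma disc_roots_of_stable p q : (forall z, is_pole p q z -> `|z| < 1) ->
  (forall z, common_zero p q z -> `|z| < 1) -> disc_roots q.
Proof.
move=> hp hc z; rewrite -{1}(divpK (dvdp_gcdr p q)) rmorphM /= rootM => /orP[|rg].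
  exact: hp.
apply: hc; apply/andP; split.
  by rewrite -(divpK (dvdp_gcdl p q)) rmorphM /= rootM rg orbT.
by rewrite -(divpK (dvdp_gcdr p q)) rmorphM /= rootM rg orbT.
Qed.

Lemma horner_mapC p (x : R) : (map_poly (real_complex R) p).[x%:C] = p.[x]%:C.
Proof. exact: horner_map. Qed.

Lemma disc_roots_neq0 q z : disc_roots q -> 1 <= `|z| ->
  (map_poly (real_complex R) q).[z] != 0.
Proof.
move=> hq z1; apply/negP => qz.
by have := lt_geF (hq z qz); rewrite z1.
Qed.

(** Both sides are coefficient sequences of power series that agree for small
    real w = 1/x > 0: multiply the expansion p(x)/q(x) by w^n q(x). *)
Lemma markov_convolution p q g n : (size p <= n.+1)%N -> (size q <= n.+1)%N ->
  disc_roots q -> expansion g p q ->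
  conv (recip n q) g =1 (fun k => (recip n p)`_k).
Proof.
move=> sp sq hq [rho hg].
pose e k := conv (recip n q) g k + -1 * (recip n p)`_k.
suff e0 : forall k, e k = 0.
  by move=> k; apply/eqP; rewrite -subr_eq0 -mulN1r; apply/eqP; exact: e0.
(* Beyond 1 the denominator has no zero, beyond rho the expansion holds. *)
pose M := Num.max 1 rho; have M0 : 0 < M by rewrite lt_max ltr01.
apply: (@pow_sum0 _ _ M^-1); first by rewrite invr_gt0.
move=> w /andP[w0 wM]; pose x := w^-1.
have wx : w = x^-1 by rewrite /x invrK.
have Mx : M < x by rewrite /x -(invrK M) ltf_pV2 // posrE invr_gt0.
have [x1 xrho] : 1 < x /\ rho < x.
  by move: Mx; rewrite gt_max => /andP.
have x0 : x != 0 by rewrite gt_eqF // (lt_trans ltr01).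
have xC : `|x%:C| = x%:C by rewrite normC_real ger0_norm // ltW // (lt_trans ltr01).
have qx : q.[x] != 0.
  have := disc_roots_neq0 hq (z := x%:C); rewrite horner_mapC xC => /(_ _)/eqP.
  by rewrite lecR ltW // => /(_ isT) h; apply/eqP => qx; apply: h; rewrite qx.
have gx : pow_sum g w (p.[x] / q.[x]).
  have /(_ _)/cvg_Re := hg x%:C; rewrite xC ltcR => /(_ xrho).
  rewrite /rat_eval !horner_mapC -fmorph_div /= /pow_sum.
  suff -> : (fun m => complex.Re (series (fun k => (g k)%:C * x%:C ^- k) m)) =
    series (fun k => g k * w ^+ k) by [].
  apply/funext => m. rewrite !seriesEord /=.
  have -> // : \sum_(k < m) (g k)%:C / x%:C ^+ k = (\sum_(k < m) g k * w ^+ k)%:C.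
  rewrite rmorph_sum; apply: eq_bigr => k _.
  by rewrite wx exprVn -rmorphXn -fmorphV -rmorphM.
have := pow_sumD (@pow_sum_conv _ (recip n q) _ _ _ gx)
   (@pow_sumZ _ (-1) _ _ _ (@pow_sum_coef _ (recip n p) w)).
rewrite (_ : (recip n q).[w] * (p.[x] / q.[x]) + -1 * (recip n p).[w] = 0) //.
rewrite wx !horner_recip //.
by field; rewrite qx expf_neq0.
Qed.

End MarkovParameters.

(** * Differentiation in normed spaces *)

Section Calculus.
Context {R : realType} {V : normedModType R}.
Implicit Types (f g : V -> R) (x v : V).

Lemma near_eq_differentiable f g x :
  (\forall y \near x, f y = g y) -> differentiable f x -> differentiable g x.
Proof.
move=> fg df; have gx : g x = f x by rewrite -(nbhs_singleton fg).
have fg0 : \forall h \near 0, f (h + x) = g (h + x).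
  have := fg; rewrite (near_shift 0 x [set y | f y = g y]) subr0.
  by apply: filterS => h.
have h : g \o shift x = cst (g x) + 'd f x +o_ 0 id.
  apply/eqaddoP => _/posnumP[eps]; rewrite gx.
  have /eqaddoP /(_ eps%:num) := diff_locally df.
  move=> /(_ [elaborate gt0 eps]).
  apply: filter_app; near=> h => /=.
  have e : f (h + x) = g (h + x) by near: h.
  change (`|f (h + x) - (f x + 'd f x h)| <= eps%:num * `|h| ->
    `|g (h + x) - (f x + 'd f x h)| <= eps%:num * `|h|).
  by rewrite e.
have dgf : 'd g x = 'd f x :> (V -> R) by apply: diff_unique h; exact: diff_continuous.
apply/diff_locallyP; rewrite dgf; split => //; exact: diff_continuous.
Unshelve. all: by end_near. Qed.

Lemma is_derive_fsum n (h : 'I_n -> V -> R) x v (dh : 'I_n -> R) :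
  (forall i, is_derive x v (h i) (dh i)) ->
  is_derive x v (fun t => \sum_(i < n) h i t) (\sum_(i < n) dh i).
Proof.
move=> hd; have -> : (fun t => \sum_(i < n) h i t) = \sum_(i < n) h i.
  by apply/funext => t; rewrite fct_sumE.
exact: is_derive_sum.
Qed.

Lemma is_derive_fmul f g x v df dg : is_derive x v f df -> is_derive x v g dg ->
  is_derive x v (fun t => f t * g t) (df * g x + f x * dg).
Proof.
move=> hf hg; apply: (is_derive_eq (is_deriveM hf hg)).
by rewrite addrC [g x *: _]mulrC.
Qed.

Lemma differentiable_fsum n (h : 'I_n -> V -> R) x :
  (forall i, differentiable (h i) x) -> differentiable (fun t => \sum_(i < n) h i t) x.
Proof.
move=> hd; have -> : (fun t => \sum_(i < n) h i t) = \sum_(i < n) h i.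
  by apply/funext => t; rewrite fct_sumE.
exact: differentiable_sum.
Qed.

Lemma differentiable_fmul f g x : differentiable f x -> differentiable g x ->
  differentiable (fun t => f t * g t) x.
Proof. by move=> df dg; exact: differentiableM. Qed.

End Calculus.

(** * Families of rational functions with coefficients depending on a parameter *)

Section Family.
Context {R : realType} {V : normedModType R}.
Variables (n : nat) (p q : V -> {poly R}) (g : V -> nat -> R) (theta : V).
Hypothesis fam : \forall t \near theta,
  [/\ (size (p t) <= n.+1)%N, (size (q t) <= n.+1)%N, q t != 0,
      disc_roots (q t) & expansion (g t) (p t) (q t)].
Hypothesis dp : forall j, differentiable (fun t => (p t)`_j) theta.
Hypothesis dq : forall j, differentiable (fun t => (q t)`_j) theta.

Let q0 := (size (q theta)).-1.

Lemma size_denominator : size (q theta) = q0.+1.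
Proof.
have [_ _ h _ _] := nbhs_singleton fam.
by rewrite /q0 prednK // size_poly_gt0.
Qed.

Lemma lead_denominator_neq0 : (q theta)`_q0 != 0.
Proof.
have [_ _ h _ _] := nbhs_singleton fam.
by rewrite -lead_coefE lead_coef_eq0.
Qed.

(** If the degree jumped from q0 to k > q0 at points close to theta, the
    coefficient of degree q0, which stays away from 0, would be at most 2^k
    times the coefficient of degree k, which tends to 0. *)
Lemma near_size_q : \forall t \near theta, (size (q t) <= q0.+1)%N.
Proof.
have cont j := differentiable_continuous (dq j).
pose l := `|(q theta)`_q0|; have l0 : 0 < l by rewrite normr_gt0 lead_denominator_neq0.
(* Below l / 2 even after multiplication by the factor 2^k <= 2^n of
   [coef_le_lead_real]. *)
have e0 : 0 < l / 2 / 2 ^+ n by rewrite !divr_gt0 // exprn_gt0.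
have h1 : \forall t \near theta, `|(q theta)`_q0 - (q t)`_q0| < l / 2.
  by move/cvgrPdist_lt : (cont q0); apply; rewrite divr_gt0.
have h2 : \forall t \near theta, forall j : 'I_n.+1,
    `|(q theta)`_j - (q t)`_j| < l / 2 / 2 ^+ n.
  by apply: filter_forall => j; move/cvgrPdist_lt : (cont j); apply.
near=> t.
have [_ st qt0 rt _] : [/\ (size (p t) <= n.+1)%N, (size (q t) <= n.+1)%N, q t != 0,
   disc_roots (q t) & expansion (g t) (p t) (q t)] by near: t.
rewrite leqNgt; apply/negP => lt.
pose k := (size (q t)).-1.
have sk : size (q t) = k.+1 by rewrite /k prednK // size_poly_gt0.
have kn : (k <= n)%N by rewrite -ltnS -sk.
have kq : (q0 < k)%N by rewrite -ltnS -sk.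
have a1 : l < `|(q t)`_q0| + l / 2.
  have : `|(q theta)`_q0 - (q t)`_q0| < l / 2 by near: t.
  have := ler_normD ((q theta)`_q0 - (q t)`_q0) (q t)`_q0.
  rewrite subrK -/l; lra.
have a2 : `|(q t)`_k| < l / 2 / 2 ^+ n.
  have : forall j : 'I_n.+1, `|(q theta)`_j - (q t)`_j| < l / 2 / 2 ^+ n by near: t.
  move=> /(_ (Ordinal (kn : (k < n.+1)%N))) /=.
  by rewrite [(q theta)`_k]nth_default ?size_denominator // sub0r normrN.
have a3 := coef_le_lead_real q0 rt.
have : 2 ^+ k * `|(q t)`_k| <= 2 ^+ n * (l / 2 / 2 ^+ n).
  by apply: ler_pM; rewrite ?exprn_ge0 ?ler_weXn2l ?ler1n // ltW.
rewrite [leRHS]mulrC divfK ?expf_neq0 // => a4.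
move: a3; rewrite lead_coefE -/k; lra.
Unshelve. all: by end_near. Qed.

(** The expansion at infinity has no positive power of z, so the degree of
    the numerator is at most that of the denominator; in the convolution
    identity the reversed denominator starts at w^(n - q0). *)
Lemma near_size_p : \forall t \near theta, (size (p t) <= q0.+1)%N.
Proof.
have q0n : (q0 <= n)%N.
  by have [_ h _ _ _] := nbhs_singleton fam; rewrite -ltnS -size_denominator.
near=> t.
have [pn st qt0 rt ex] : [/\ (size (p t) <= n.+1)%N, (size (q t) <= n.+1)%N, q t != 0,
   disc_roots (q t) & expansion (g t) (p t) (q t)] by near: t.
have sq : (size (q t) <= q0.+1)%N by near: t; exact: near_size_q.
apply/leq_sizeP => j jq; case: (leqP j n) => jn; last first.
  by apply: nth_default; apply: leq_trans pn _.
have := markov_convolution pn st rt ex (n - j)%N.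
rewrite (recip_widen q0n sq) convXn coef_recip leq_subr subKn //.
by have -> : (n - q0 <= n - j)%N = false by lia.
Unshelve. all: by end_near. Qed.

Lemma near_convolution : \forall t \near theta,
  forall k, conv (recip q0 (q t)) (g t) k = (recip q0 (p t))`_k.
Proof.
near=> t => k.
have [_ _ _ rt ex] : [/\ (size (p t) <= n.+1)%N, (size (q t) <= n.+1)%N, q t != 0,
   disc_roots (q t) & expansion (g t) (p t) (q t)] by near: t.
apply: markov_convolution => //.
  by near: t; exact: near_size_p.
by near: t; exact: near_size_q.
Unshelve. all: by end_near. Qed.

Lemma differentiable_recip (r : V -> {poly R}) k :
  (forall j, differentiable (fun t => (r t)`_j) theta) ->
  differentiable (fun t => (recip q0 (r t))`_k) theta.
Proof.
move=> hr; under eq_fun do rewrite coef_recip.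
by case: (k <= q0)%N => //; exact: differentiable_cst.
Qed.

(** The recursion can be solved for [g t k] near theta, as the constant term
    of the reversed denominator is its leading coefficient, nonzero at theta. *)
Lemma differentiable_markov k : differentiable (fun t => g t k) theta.
Proof.
elim/ltn_ind: k => k IH.
pose F t := ((q t)`_q0)^-1 *
  ((recip q0 (p t))`_k - \sum_(j < k) (recip q0 (q t))`_j.+1 * g t (k - j.+1)%N).
apply: (@near_eq_differentiable _ _ F).
  have qn0 : \forall t \near theta, (q t)`_q0 != 0.
    have cont := differentiable_continuous (dq q0).
    exact: (@cvgr_neq0 _ _ _ _ _ (fun t => (q t)`_q0) _ cont lead_denominator_neq0).
  near=> t.
  have : conv (recip q0 (q t)) (g t) k = (recip q0 (p t))`_k.
    by near: t; apply: filterS near_convolution.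
  rewrite /F => <-; rewrite /conv big_ord_recl coef_recip /= !subn0 addrK mulKf //.
  by near: t.
apply: differentiable_fmul.
  by apply: differentiableV => //; exact: lead_denominator_neq0.
apply: differentiableB; first exact: differentiable_recip.
apply: differentiable_fsum => j; apply: differentiable_fmul.
  exact: differentiable_recip.
by apply: IH; rewrite ltn_subrL /= (leq_ltn_trans _ (ltn_ord j)).
Unshelve. all: by end_near. Qed.

(** Truncation at q0 loses nothing: near theta the coefficients of higher
    degree of the numerator and denominator vanish identically. *)
Definition dpoly (r : V -> {poly R}) v : {poly R} :=
  \poly_(j < q0.+1) 'D_v (fun t => (r t)`_j) theta.

Lemma is_derive_recip (r : V -> {poly R}) k v :
  (forall j, differentiable (fun t => (r t)`_j) theta) ->
  is_derive theta v (fun t => (recip q0 (r t))`_k) (recip q0 (dpoly r v))`_k.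
Proof.
move=> hr; rewrite coef_recip; under eq_fun do rewrite coef_recip.
case: (k <= q0)%N; last exact: is_derive_cst.
rewrite coef_poly ltnS leq_subr; apply/derivableP.
exact: diff_derivable.
Qed.

Definition dmarkov v k : R := 'D_v (fun t => g t k) theta.

Lemma dmarkov_convolution v k : conv (recip q0 (q theta)) (dmarkov v) k =
  (recip q0 (dpoly p v))`_k - conv (recip q0 (dpoly q v)) (g theta) k.
Proof.
have dlhs : is_derive theta v (fun t => conv (recip q0 (q t)) (g t) k)
    (\sum_(j < k.+1) ((recip q0 (dpoly q v))`_j * g theta (k - j)%N +
                      (recip q0 (q theta))`_j * dmarkov v (k - j)%N)).
  apply: is_derive_fsum => j; apply: is_derive_fmul; first exact: is_derive_recip.
  by apply/derivableP/diff_derivable; exact: differentiable_markov.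
have drhs := is_derive_recip k v dp.
have near_eq : \forall t \near theta,
    conv (recip q0 (q t)) (g t) k = (recip q0 (p t))`_k.
  by apply: filterS near_convolution.
have [_ hl] := near_eq_is_derive near_eq dlhs; case: drhs => _ hr.
by rewrite -hr hl big_split /= [X in X - _]addrC addrK.
Qed.

Lemma ell1_markov : ell1 (g theta).
Proof.
have [_ _ _ rt _] := nbhs_singleton fam.
apply: (ell1_div_real size_denominator rt).
apply: eq_ell1 (ell1_coef (recip q0 (p theta))) => k.
by rewrite (nbhs_singleton near_convolution).
Qed.

Lemma ell1_dmarkov v : ell1 (dmarkov v).
Proof.
have [_ _ _ rt _] := nbhs_singleton fam.
apply: (ell1_div_real size_denominator rt).
apply: (@eq_ell1 _ (fun k => (recip q0 (dpoly p v))`_k +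
    -1 * conv (recip q0 (dpoly q v)) (g theta) k)) => [k|].
  by rewrite dmarkov_convolution mulN1r.
apply: ell1D; first exact: ell1_coef.
apply: (ell1Z (-1)); apply: ell1_conv; exact: ell1_markov.
Qed.

End Family.

(** * Partial derivatives of the transfer function on the unit circle *)

Section ComplexCalculus.
Context {R : realType} {V : normedModType R}.
Implicit Types (F G : V -> R[i]) (x v : V) (X Y z : R[i]).

(** Directional derivative of a function with values in R[i], which is normed
    over itself and not over R; hence the two real components. *)
Definition is_cderive x v F X : Prop :=
  is_derive x v (fun t => complex.Re (F t)) (complex.Re X) /\
  is_derive x v (fun t => complex.Im (F t)) (complex.Im X).

Lemma is_derive_finv (f : V -> R) x v df : f x != 0 -> is_derive x v f df ->
  is_derive x v (fun t => (f t)^-1) (- (f x) ^- 2 * df).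
Proof.
move=> f0 [fx <-]; apply: DeriveDef; first exact: derivableV.
by rewrite deriveV.
Qed.

Lemma ReM X Y : complex.Re (X * Y) =
  complex.Re X * complex.Re Y - complex.Im X * complex.Im Y.
Proof. by case: X Y => a b [c d]. Qed.

Lemma ImM X Y : complex.Im (X * Y) =
  complex.Re X * complex.Im Y + complex.Im X * complex.Re Y.
Proof. by case: X Y => a b [c d]. Qed.

Lemma is_cderiveM x v F G X Y : is_cderive x v F X -> is_cderive x v G Y ->
  is_cderive x v (fun t => F t * G t) (X * G x + F x * Y).
Proof.
move=> [Fr Fi] [Gr Gi]; split.
  under eq_fun do rewrite ReM.
  apply: is_derive_eq (is_deriveB (is_derive_fmul Fr Gr) (is_derive_fmul Fi Gi)) _.
  by rewrite (raddfD (@complex.Re R : Rcomplex R -> R)) /= !ReM; ring.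
under eq_fun do rewrite ImM.
apply: is_derive_eq (is_deriveD (is_derive_fmul Fr Gi) (is_derive_fmul Fi Gr)) _.
by rewrite (raddfD (@complex.Im R : Rcomplex R -> R)) /= !ImM; ring.
Qed.

Lemma is_cderiveV x v F X : F x != 0 -> is_cderive x v F X ->
  is_cderive x v (fun t => (F t)^-1) (- (X / F x ^+ 2)).
Proof.
move=> F0 [Fr Fi].
pose m t := complex.Re (F t) * complex.Re (F t) + complex.Im (F t) * complex.Im (F t).
have ReV t : complex.Re (F t)^-1 = complex.Re (F t) * (m t)^-1.
  by rewrite /m; case: (F t) => a b /=; rewrite !expr2.
have ImV t : complex.Im (F t)^-1 = - complex.Im (F t) * (m t)^-1.
  by rewrite /m; case: (F t) => a b /=; rewrite !expr2 mulNr.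
have m0 : m x != 0.
  apply: contra F0; rewrite /m -!expr2 paddr_eq0 ?sqr_ge0 // !sqrf_eq0.
  by case: (F x) => a b /= /andP[/eqP -> /eqP ->].
have dm : is_derive x v m _ := is_deriveD (is_derive_fmul Fr Fr) (is_derive_fmul Fi Fi).
have dV := @is_derive_finv m _ _ _ m0 dm.
have E : complex.Re (- (X / F x ^+ 2)) =
    complex.Re X * (m x)^-1 + complex.Re (F x) *
      (- (m x) ^- 2 * (complex.Re X * complex.Re (F x) + complex.Re (F x) * complex.Re X +
                      (complex.Im X * complex.Im (F x) + complex.Im (F x) * complex.Im X))) /\
    complex.Im (- (X / F x ^+ 2)) =
    - complex.Im X * (m x)^-1 + - complex.Im (F x) *
      (- (m x) ^- 2 * (complex.Re X * complex.Re (F x) + complex.Re (F x) * complex.Re X +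
                      (complex.Im X * complex.Im (F x) + complex.Im (F x) * complex.Im X))).
  rewrite -exprVn expr2; move: m0; rewrite /m.
  move: (F x) => Y; clear -X; case: X Y => c d [a b] /= m0; split; field; exact: m0.
split.
  under eq_fun do rewrite ReV.
  by apply: is_derive_eq (is_derive_fmul Fr dV) _; rewrite E.1.
under eq_fun do rewrite ImV.
by apply: is_derive_eq (is_derive_fmul (is_deriveN Fi) dV) _; rewrite E.2.
Qed.

Lemma near_eq_is_cderive x v F G X : (\forall t \near x, F t = G t) ->
  is_cderive x v F X -> is_cderive x v G X.
Proof.
by move=> FG [Fr Fi]; split; [apply: near_eq_is_derive Fr | apply: near_eq_is_derive Fi];
  apply: filterS FG => t ->.
Qed.

End ComplexCalculus.

Section EvaluationOnCircle.
Context {R : realType}.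
Implicit Types (u : nat -> R) (z : R[i]).

Lemma ell1_cvg u : ell1 u -> cvgn (series u).
Proof.
move=> [M uM]; apply: normed_cvg; apply: nondecreasing_is_cvgn.
  by apply: nondecreasing_series => k _ _; exact: normr_ge0.
by exists M => _ [k _ <-]; have := uM k; rewrite -(big_mkord xpredT (fun i => `|u i|)).
Qed.

Lemma ell1_mul_bounded u a : (forall k, `|a k| <= 1) -> ell1 u -> ell1 (fun k => u k * a k).
Proof.
move=> a1 [M uM]; exists M => k; apply: le_trans (uM k).
by apply: ler_sum => j _; rewrite normrM ler_piMr.
Qed.

Lemma ell1_pow_sum u z : `|z| = 1 -> ell1 u ->
  exists X, pow_sum (fun k => (u k)%:C) z X.
Proof.
move=> z1 u1; have zk k : `|z ^+ k| = 1 by rewrite normrX z1 expr1n.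
have re1 k : `|complex.Re (z ^+ k)| <= 1.
  by rewrite -lecR; apply: le_trans (normc_ge_Re _) _; rewrite zk.
have im1 k : `|complex.Im (z ^+ k)| <= 1.
  by rewrite -lecR; apply: le_trans (normc_ge_Im _) _; rewrite zk.
have cr := ell1_cvg (ell1_mul_bounded re1 u1).
have ci := ell1_cvg (ell1_mul_bounded im1 u1).
exists (lim (series (fun k => u k * complex.Re (z ^+ k)) @ \oo) +i*
        lim (series (fun k => u k * complex.Im (z ^+ k)) @ \oo)).
have E k : series (fun k => (u k)%:C * z ^+ k) k =
   series (fun k => u k * complex.Re (z ^+ k)) k +i* series (fun k => u k * complex.Im (z ^+ k)) k.
  elim: k => [|k IH]; first by rewrite /series /= !big_geq.
  by rewrite !seriesSr IH; case: (z ^+ k) => a b; simpc.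
apply: cvg_ReIm => /=.
  by under eq_fun do rewrite E.
by under eq_fun do rewrite E.
Qed.

End EvaluationOnCircle.

Section PartialDerivatives.
Context {R : realType} {V : normedModType R}.
Variables (n : nat) (p q : V -> {poly R}) (g : V -> nat -> R) (theta : V).
Hypothesis fam : \forall t \near theta,
  [/\ (size (p t) <= n.+1)%N, (size (q t) <= n.+1)%N, q t != 0,
      disc_roots (q t) & expansion (g t) (p t) (q t)].
Hypothesis dp : forall j, differentiable (fun t => (p t)`_j) theta.
Hypothesis dq : forall j, differentiable (fun t => (q t)`_j) theta.

Let q0 := (size (q theta)).-1.
Local Notation toC := (map_poly (real_complex R)).

Lemma is_cderive_horner (r : V -> {poly R}) v (z : R[i]) :
  (forall j, differentiable (fun t => (r t)`_j) theta) ->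
  (\forall t \near theta, (size (r t) <= q0.+1)%N) ->
  is_cderive theta v (fun t => (toC (r t)).[z]) (toC (dpoly q theta r v)).[z].
Proof.
move=> dr sr.
pose F t := \sum_(j < q0.+1) ((r t)`_j)%:C * z ^+ j.
apply: (@near_eq_is_cderive _ _ _ _ F).
  apply: filterS sr => t st; rewrite /F (@horner_coef_wide _ q0.+1) ?size_map_poly //.
  by apply: eq_bigr => j _; rewrite coef_map.
have -> : (toC (dpoly q theta r v)).[z] =
    \sum_(j < q0.+1) ('D_v (fun t => (r t)`_j) theta)%:C * z ^+ j.
  rewrite (@horner_coef_wide _ q0.+1); last by rewrite size_map_poly size_poly.
  by apply: eq_bigr => j _; rewrite coef_map coef_poly ltn_ord.
have ReF m (a : nat -> R) : complex.Re (\sum_(j < m) (a j)%:C * z ^+ j) =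
    \sum_(j < m) a j * complex.Re (z ^+ j).
  elim: m => [|m IH]; first by rewrite !big_ord0.
  by rewrite !big_ord_recr /= -IH; case: (\sum_(j < m) _) (z ^+ m) => ? ? [? ?]; simpc.
have ImF m (a : nat -> R) : complex.Im (\sum_(j < m) (a j)%:C * z ^+ j) =
    \sum_(j < m) a j * complex.Im (z ^+ j).
  elim: m => [|m IH]; first by rewrite !big_ord0.
  by rewrite !big_ord_recr /= -IH; case: (\sum_(j < m) _) (z ^+ m) => ? ? [? ?]; simpc.
have dcoef (c : R) j : is_derive theta v (fun t => (r t)`_j * c)
    ('D_v (fun t => (r t)`_j) theta * c).
  apply: is_derive_eq (is_derive_fmul _ (is_derive_cst c theta v)) _.
    exact/derivableP/diff_derivable.
  by rewrite mulr0 addr0.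
split.
  under eq_fun do rewrite (ReF _ (fun j => (r _)`_j)).
  by rewrite (ReF _ (fun j => 'D_v (fun t => (r t)`_j) theta)); apply: is_derive_fsum => j.
under eq_fun do rewrite (ImF _ (fun j => (r _)`_j)).
by rewrite (ImF _ (fun j => 'D_v (fun t => (r t)`_j) theta)); apply: is_derive_fsum => j.
Qed.

(** The sum X on the left and the sum G of the Markov parameters exist by
    absolute summability; evaluating the recursion and its derivative at 1/z
    gives q G = p and q X = dp - dq G, which is the quotient rule. *)
Lemma pow_sum_partial v (z : R[i]) : `|z| = 1 ->
  pow_sum (fun k => (dmarkov g theta v k)%:C) z^-1
    ('D_v (fun t => complex.Re (rat_eval (p t) (q t) z)) theta +i*
     'D_v (fun t => complex.Im (rat_eval (p t) (q t) z)) theta).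
Proof.
move=> z1.
have z0 : z != 0 by rewrite -normr_eq0 z1 oner_eq0.
have zV1 : `|z^-1| = 1 by rewrite normfV z1 invr1.
have [X hX] := ell1_pow_sum zV1 (ell1_dmarkov fam dp dq v).
have [G hG] := ell1_pow_sum zV1 (ell1_markov fam dq).
have sp := near_size_p fam dq; have sq := near_size_q fam dq.
have [_ _ _ rt _] := nbhs_singleton fam.
have Q0 : (toC (q theta)).[z] != 0 by apply: disc_roots_neq0 => //; rewrite z1.
have sd r : (size (toC (dpoly q theta r v)) <= q0.+1)%N.
  by rewrite size_map_poly size_poly.
have EG : (toC (q theta)).[z] * G = (toC (p theta)).[z].
  have e k : conv (recip q0 (toC (q theta))) (fun j => (g theta j)%:C) k =
      (recip q0 (toC (p theta)))`_k.
    rewrite -map_recip -(map_conv (real_complex R)).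
    by rewrite (nbhs_singleton (near_convolution fam dq)) -map_recip coef_map.
  have h1 := @pow_sum_conv _ (recip q0 (toC (q theta))) _ _ _ hG.
  have h2 := @pow_sum_coef _ (recip q0 (toC (p theta))) z^-1.
  have := pow_sum_unique (eq_pow_sum e h1) h2.
  rewrite !horner_recip ?size_map_poly ?(nbhs_singleton sp) ?(nbhs_singleton sq) //.
  by move=> /(congr1 ( *%R^~ (z ^+ q0))); rewrite mulrAC !divfK ?expf_neq0.
have EX : (toC (q theta)).[z] * X =
   (toC (dpoly q theta p v)).[z] - (toC (dpoly q theta q v)).[z] * G.
  have e k : conv (recip q0 (toC (q theta))) (fun j => (dmarkov g theta v j)%:C) k =
      (recip q0 (toC (dpoly q theta p v)))`_k +
      -1 * conv (recip q0 (toC (dpoly q theta q v))) (fun j => (g theta j)%:C) k.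
    rewrite -!map_recip -!(map_conv (real_complex R)) coef_map.
    by rewrite (dmarkov_convolution fam dp dq) rmorphB mulN1r.
  have h1 := @pow_sum_conv _ (recip q0 (toC (q theta))) _ _ _ hX.
  have h2 := @pow_sum_coef _ (recip q0 (toC (dpoly q theta p v))) z^-1.
  have h3 := @pow_sum_conv _ (recip q0 (toC (dpoly q theta q v))) _ _ _ hG.
  have h4 := pow_sumD h2 (@pow_sumZ _ (-1) _ _ _ h3).
  have := pow_sum_unique (eq_pow_sum e h1) h4.
  rewrite !horner_recip ?sd ?size_map_poly ?(nbhs_singleton sp) ?(nbhs_singleton sq) //.
  move: (expf_neq0 q0 z0); set zq := z ^+ q0 => zq0 h.
  by apply: (mulIf (invr_neq0 zq0)); rewrite mulrAC h; field.
(* Now X is the derivative given by the product and inverse rules. *)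
have XE : X = (toC (dpoly q theta p v)).[z] * (toC (q theta)).[z]^-1 +
    (toC (p theta)).[z] * (- ((toC (dpoly q theta q v)).[z] / (toC (q theta)).[z] ^+ 2)).
  apply: (mulfI Q0); rewrite EX -EG; field; exact: Q0.
have [[_ Dr] [_ Di]] : is_cderive theta v (fun t => rat_eval (p t) (q t) z) X.
  rewrite XE; apply: is_cderiveM; first exact: is_cderive_horner.
  by apply: is_cderiveV => //; exact: is_cderive_horner.
by rewrite Dr Di; case: X hX {EX XE Dr Di} => a b.
Qed.

End PartialDerivatives.

(** * Integrals over the unit circle and Parseval's identity *)

Section CircleMeans.
Context {R : realType}.
Implicit Types (f g : R -> R) (c : R).
Local Notation mu := (@lebesgue_measure R).
Local Notation circle_itv := (`[0, 2 * pi]%classic : set R).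

(** Continuity is carried along because additivity of the integral needs
    integrability of each summand. *)
Definition has_circle_int f c : Prop :=
  continuous f /\ Rintegral mu circle_itv f = c.

Lemma circle_itv_integrable f : continuous f -> mu.-integrable circle_itv (EFin \o f).
Proof.
move=> cf; apply: continuous_compact_integrable; first exact: segment_compact.
exact: continuous_subspaceT.
Qed.

Lemma has_circle_intD f g c d : has_circle_int f c -> has_circle_int g d ->
  has_circle_int (fun t => f t + g t) (c + d).
Proof.
move=> [cf <-] [cg <-]; split; first by move=> t; apply: cvgD; [exact: cf|exact: cg].
by rewrite RintegralD //; exact: circle_itv_integrable.
Qed.

Lemma has_circle_intZ f c r : has_circle_int f c -> has_circle_int (fun t => r * f t) (r * c).
Proof.
move=> [cf <-]; split; first by move=> t; apply: cvgMl_tmp; exact: cf.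
by rewrite RintegralZl //; exact: circle_itv_integrable.
Qed.

Lemma has_circle_int_FTC f F : continuous f ->
  (forall t : R, is_derive t 1 F (f t)) -> has_circle_int f (F (2 * pi) - F 0).
Proof.
move=> cf dF; split => //.
have pi0 : 0 < 2 * pi :> R by rewrite mulr_gt0 // pi_gt0.
have cF : continuous F.
  by move=> t; apply: differentiable_continuous; apply/derivable1_diffP; case: (dF t).
rewrite /Rintegral (@continuous_FTC2 _ _ F) //.
- exact: continuous_subspaceT.
- split.
  + by move=> t _; case: (dF t).
  + by apply: cvg_at_right_filter; exact: cF.
  + by apply: cvg_at_left_filter; exact: cF.
- by move=> t _; rewrite derive1E; case: (dF t).
Qed.

Lemma eq_has_circle_int f g c d : f =1 g -> c = d -> has_circle_int f c -> has_circle_int g d.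
Proof. by move=> /funext -> ->. Qed.

Lemma has_circle_int_cst r : has_circle_int (fun=> r) (r * (2 * pi)).
Proof.
apply: (@eq_has_circle_int (fun=> r) _ (r * (2 * pi) - r * 0)) => //.
  by rewrite mulr0 subr0.
apply: (@has_circle_int_FTC (fun=> r) (fun t => r * t)); first by move=> t; exact: cvg_cst.
move=> t; apply: is_derive_eq (is_derive_fmul (is_derive_cst r t 1) (is_derive_id t 1)) _.
by rewrite mul0r add0r mulr1.
Qed.

Lemma is_derive_linear_comp f c (t d : R) : is_derive (c * t) 1 f d ->
  is_derive t 1 (fun s => f (c * s)) (c * d).
Proof.
move=> fd; rewrite mulrC; apply: (is_derive1_comp (g := *%R c) fd).
apply: is_derive_eq (is_derive_fmul (is_derive_cst c t 1) (is_derive_id t 1)) _.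
by rewrite mul0r add0r mulr1.
Qed.

Lemma sin_cos_period n : sin (n%:R * (2 * pi)) = 0 :> R /\ cos (n%:R * (2 * pi)) = 1 :> R.
Proof.
have -> : n%:R * (2 * pi) = 0 + (pi *+ 2) *+ n :> R.
  by rewrite add0r -[RHS]mulr_natl [2 * pi]mulr_natl.
by rewrite (periodicn (@sinD2pi R)) (periodicn (@cosD2pi R)) sin0 cos0.
Qed.

(** The difference is taken in R, as the frequency may be negative. *)
Lemma sin_cos_periodB k l : let c := l%:R - k%:R in
  sin (c * (2 * pi)) = 0 :> R /\ cos (c * (2 * pi)) = 1 :> R.
Proof.
have [sk ck] := sin_cos_period k; have [sl cl] := sin_cos_period l.
by rewrite /= mulrBl sinB cosB sk ck sl cl; split; ring.
Qed.

Lemma continuous_linear_comp f c : continuous f -> continuous (fun t => f (c * t)).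
Proof.
move=> cf t; apply: continuous_comp; last exact: cf.
by apply: cvgMl_tmp; exact: cvg_id.
Qed.

Lemma has_circle_int_cos k l :
  has_circle_int (fun t => cos ((l%:R - k%:R) * t)) ((k == l)%:R * (2 * pi)).
Proof.
have [->|kl] := eqVneq k l.
  apply: (@eq_has_circle_int (fun=> 1)) (has_circle_int_cst 1) => // t.
  by rewrite subrr mul0r cos0.
have c0 : l%:R - k%:R != 0 :> R by rewrite subr_eq0 eqr_nat eq_sym.
have [s2 _] := sin_cos_periodB k l.
set c := _ - _ in c0 s2 *.
pose F t : R := c^-1 * sin (c * t).
apply: (@eq_has_circle_int (fun t => cos (c * t)) _ (F (2 * pi) - F 0)) => //.
  by rewrite /F s2 !mulr0 sin0 mulr0 subrr mul0r.
apply: has_circle_int_FTC; first by apply: continuous_linear_comp; exact: continuous_cos.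
move=> t.
apply: is_derive_eq (is_derive_fmul (is_derive_cst c^-1 t 1)
  (is_derive_linear_comp (is_derive_sin (c * t)))) _.
by rewrite mul0r add0r mulrA mulVf // mul1r.
Qed.

Lemma has_circle_int_sin k l : has_circle_int (fun t => sin ((l%:R - k%:R) * t)) 0.
Proof.
have [->|kl] := eqVneq k l.
  apply: (@eq_has_circle_int (fun=> 0)) (has_circle_int_cst 0) => [t|].
    by rewrite subrr mul0r sin0.
  by rewrite mul0r.
have c0 : l%:R - k%:R != 0 :> R by rewrite subr_eq0 eqr_nat eq_sym.
have [_ c2] := sin_cos_periodB k l.
set c := _ - _ in c0 c2 *.
pose F t : R := - c^-1 * cos (c * t).
apply: (@eq_has_circle_int (fun t => sin (c * t)) _ (F (2 * pi) - F 0)) => //.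
  by rewrite /F c2 mulr0 cos0 subrr.
apply: has_circle_int_FTC; first by apply: continuous_linear_comp; exact: continuous_sin.
move=> t.
apply: is_derive_eq (is_derive_fmul (is_derive_cst (- c^-1) t 1)
  (is_derive_linear_comp (is_derive_cos (c * t)))) _.
by rewrite mul0r add0r !mulrN mulNr opprK mulKf.
Qed.

Lemma circle_int_limit (f : nat -> R -> R) g (c : nat -> R) (d M : R) :
  (forall n, has_circle_int (f n) (c n)) -> (forall n t, `|f n t| <= M) ->
  (forall t, (fun n => f n t) @ \oo --> g t) -> c @ \oo --> d ->
  Rintegral mu circle_itv g = d.
Proof.
move=> hf fM fg cd.
have fi n : mu.-integrable circle_itv (EFin \o f n).
  by apply: circle_itv_integrable; exact: (hf n).1.
have mf n := measurable_int mu (fi n).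
have mfR n : measurable_fun circle_itv (f n) by apply/measurable_EFinP; exact: mf.
have mg : measurable_fun circle_itv g.
  by apply: (measurable_fun_cvg mfR) => t _; exact: fg.
have iM : mu.-integrable circle_itv (EFin \o (fun=> M)).
  by apply: circle_itv_integrable => t; exact: cvg_cst.
have fgE : {ae mu, forall t, circle_itv t ->
    (fun n => (EFin \o f n) t) @ \oo --> (EFin \o g) t}.
  by apply: aeW => t _; apply: cvg_EFin; [exact: nearW | exact: fg].
have fME : {ae mu, forall t n, circle_itv t -> (`|(EFin \o f n) t| <= (EFin \o (fun=> M)) t)%E}.
  by apply: aeW => t n _ /=; rewrite lee_fin; exact: fM.
have [_ _ lim] := dominated_convergence (mu := mu) (measurable_itv _) mf
  ((measurable_EFinP _ _).2 mg) fgE iM fME.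
have lim2 : (fun n => (c n)%:E) @ \oo --> (d%:E)%E.
  by apply: cvg_EFin; [exact: nearW | exact: cd].
have E : (fun n => (c n)%:E) = [sequence (\int[mu]_(x in circle_itv) (EFin \o f n) x)%E]_n.
  apply/funext => n /=; rewrite -(hf n).2 /Rintegral fineK //.
  apply: integrable_fin_num => //. exact: fi.
move: lim2; rewrite E => lim2.
by rewrite /Rintegral (cvg_unique _ lim lim2).
Qed.

End CircleMeans.

Lemma cvg_fsum (K : numFieldType) (I : Type) (s : seq I) (f : I -> nat -> K) (l : I -> K) :
  (forall i, (f i : nat -> K^o) @ \oo --> (l i : K^o)) ->
  ((fun n => \sum_(i <- s) f i n) : nat -> K^o) @ \oo --> (\sum_(i <- s) l i : K^o).
Proof.
move=> fl; elim: s => [|i s IH].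
  by rewrite big_nil; under eq_fun do rewrite big_nil; exact: cvg_cst.
by rewrite big_cons; under eq_fun do rewrite big_cons; exact: cvgD.
Qed.

Section Parseval.
Context {R : realType}.
Implicit Types (t : R) (F : R -> R[i]) (C : R[i]).

Definition unit_circle t : R[i] := cos t +i* sin t.

Lemma norm_unit_circle t : `|unit_circle t| = 1.
Proof. by rewrite normc_def /= cos2Dsin2 sqrtr1. Qed.

Lemma unit_circle_neq0 t : unit_circle t != 0.
Proof. by rewrite -normr_eq0 norm_unit_circle oner_eq0. Qed.

Lemma unit_circleM s t : unit_circle s * unit_circle t = unit_circle (s + t).
Proof. by rewrite /unit_circle cosD sinD; simpc; congr (_ +i* _); ring. Qed.

Lemma unit_circleX t n : unit_circle t ^+ n = unit_circle (n%:R * t).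
Proof.
elim: n => [|n IH]; first by rewrite expr0 mul0r /unit_circle cos0 sin0.
by rewrite exprS IH unit_circleM -[n.+1]add1n natrD mulrDl mul1r.
Qed.

Lemma unit_circleV t : (unit_circle t)^-1 = unit_circle (- t).
Proof.
apply: (mulfI (unit_circle_neq0 t)); rewrite mulfV ?unit_circle_neq0 //.
by rewrite unit_circleM subrr /unit_circle cos0 sin0.
Qed.

Definition has_circle_cint F C : Prop :=
  has_circle_int (fun t => complex.Re (F t)) (complex.Re C) /\
  has_circle_int (fun t => complex.Im (F t)) (complex.Im C).

Lemma eq_has_circle_cint F G C : F =1 G -> has_circle_cint F C -> has_circle_cint G C.
Proof. by move=> /funext ->. Qed.

Lemma has_circle_cint_sum (I : Type) (s : seq I) (F : I -> R -> R[i]) (C : I -> R[i]) :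
  (forall i, has_circle_cint (F i) (C i)) ->
  has_circle_cint (fun t => \sum_(i <- s) F i t) (\sum_(i <- s) C i).
Proof.
move=> FC; elim: s => [|i s [IHr IHi]].
  split; rewrite big_nil; under eq_fun do rewrite big_nil.
    by apply: eq_has_circle_int (has_circle_int_cst 0); rewrite ?mul0r.
  by apply: eq_has_circle_int (has_circle_int_cst 0); rewrite ?mul0r.
split; rewrite big_cons; under eq_fun do rewrite big_cons.
  apply: eq_has_circle_int (has_circle_intD (FC i).1 IHr) => [t|].
    by rewrite (raddfD (@complex.Re R : Rcomplex R -> R)).
  by rewrite (raddfD (@complex.Re R : Rcomplex R -> R)).
apply: eq_has_circle_int (has_circle_intD (FC i).2 IHi) => [t|].
  by rewrite (raddfD (@complex.Im R : Rcomplex R -> R)).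
by rewrite (raddfD (@complex.Im R : Rcomplex R -> R)).
Qed.

(** Orthogonality of the powers of z on the unit circle. *)
Lemma has_circle_cint_monomial (c : R) k l :
  has_circle_cint (fun t => c%:C * ((unit_circle t)^-1 ^+ k * unit_circle t ^+ l))
    (2 * pi * (c * (k == l)%:R))%:C.
Proof.
have E t : (unit_circle t)^-1 ^+ k * unit_circle t ^+ l = unit_circle ((l%:R - k%:R) * t).
  by rewrite unit_circleV !unit_circleX unit_circleM; congr unit_circle; ring.
under eq_fun do rewrite E.
split => /=.
  apply: eq_has_circle_int (has_circle_intZ c (has_circle_int_cos k l)) => [t|].
    by rewrite /= mul0r subr0.
  ring.
apply: eq_has_circle_int (has_circle_intZ c (has_circle_int_sin k l)) => [t|].
  by rewrite /= mul0r addr0.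
by rewrite mulr0.
Qed.

Lemma has_circle_cint_mulI F C :
  has_circle_cint F C -> has_circle_cint (fun t => 'i%C * F t) ('i%C * C).
Proof.
move=> [Fr Fi]; split.
  apply: eq_has_circle_int (has_circle_intZ (-1) Fi) => [t|].
    by rewrite ReM /= mul0r mul1r sub0r mulN1r.
  by rewrite ReM /= mul0r mul1r sub0r mulN1r.
apply: eq_has_circle_int Fr => [t|].
  by rewrite ImM /= mul0r mul1r add0r.
by rewrite ImM /= mul0r mul1r add0r.
Qed.

Lemma circle_cint_limit (f : nat -> R -> R[i]) g (c : nat -> R[i]) d M :
  (forall n, has_circle_cint (f n) (c n)) -> (forall n t, `|f n t| <= M) ->
  (forall t, (fun n => f n t : R[i]^o) @ \oo --> (g t : R[i]^o)) ->
  (c : nat -> R[i]^o) @ \oo --> (d : R[i]^o) ->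
  Rintegral (@lebesgue_measure R) `[0, 2 * pi] (fun t => complex.Re (g t)) = complex.Re d /\
  Rintegral (@lebesgue_measure R) `[0, 2 * pi] (fun t => complex.Im (g t)) = complex.Im d.
Proof.
move=> fc fM fg cd.
have M_ge n t : complex.Re `|f n t| <= complex.Re M.
  by have := fM n t; rewrite lecE => /andP[].
split.
  apply: (circle_int_limit (fun n => (fc n).1) (M := complex.Re M)) => [n t|t|].
  - apply: le_trans (M_ge n t).
    by have := normc_ge_Re (f n t); rewrite lecE => /andP[].
  - exact: (cvg_Re (fg t)).
  - exact: (cvg_Re cd).
apply: (circle_int_limit (fun n => (fc n).2) (M := complex.Re M)) => [n t|t|].
- apply: le_trans (M_ge n t).
  by have := normc_ge_Im (f n t); rewrite lecE => /andP[].
- exact: (cvg_Im (fg t)).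
- exact: (cvg_Im cd).
Qed.

Lemma norm_series_le (u : nat -> R) (z : R[i]) M n : `|z| = 1 ->
  (forall n, \sum_(k < n) `|(u k)%:C| <= M) ->
  `|series (fun k => (u k)%:C * z ^+ k) n| <= M.
Proof.
move=> z1 uM; rewrite seriesEord /=; apply: le_trans (uM n).
apply: le_trans (ler_norm_sum _ _ _) _; apply: ler_sum => k _.
by rewrite normrM normrX z1 expr1n mulr1.
Qed.

(** For the partial sums the identity is orthogonality of the powers of z.
    The partial sums converge at each point of the circle and are bounded by
    products of absolute sums, so dominated convergence gives the limit. *)
Lemma circle_integral_parseval (I : finType) (a b : I -> nat -> R) (A B : R[i] -> I -> R[i])
    (l : I -> R) :
  (forall i, ell1 (a i)) -> (forall i, ell1 (b i)) ->
  (forall i z, `|z| = 1 -> pow_sum (fun k => (a i k)%:C) z^-1 (A z i)) ->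
  (forall i z, `|z| = 1 -> pow_sum (fun k => (b i k)%:C) z (B z i)) ->
  (forall i, series (fun k => a i k * b i k) @ \oo --> l i) ->
  (2 * pi%:C * 'i%C)^-1 * circle_integral (fun z => (\sum_i A z i * B z i) * z^-1) =
  (\sum_i l i)%:C.
Proof.
move=> a1 b1 hA hB hl.
have [Ma hMa] := choice (fun i => (ell1_realC (a i)).1 (a1 i)).
have [Mb hMb] := choice (fun i => (ell1_realC (b i)).1 (b1 i)).
(* The factor 'i comes from dz = i z dt, with z cancelled by z^-1. *)
pose F t := 'i%C * \sum_i A (unit_circle t) i * B (unit_circle t) i.
pose f n t := 'i%C * \sum_i series (fun k => (a i k)%:C * (unit_circle t)^-1 ^+ k) n *
  series (fun k => (b i k)%:C * unit_circle t ^+ k) n.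
pose c n := (2 * pi * \sum_i series (fun k => a i k * b i k) n)%:C.
have fc n : has_circle_cint (f n) ('i%C * c n).
  apply: has_circle_cint_mulI.
  have -> : c n = \sum_i \sum_(k < n) \sum_(j < n) (2 * pi * (a i k * b i j * (k == j)%:R))%:C.
    rewrite /c mulr_sumr rmorph_sum; apply: eq_bigr => i _.
    rewrite seriesEord /= mulr_sumr rmorph_sum; apply: eq_bigr => k _.
    rewrite (bigD1 k) //= eqxx mulr1 big1 ?addr0 // => j jk.
    by rewrite eq_sym (negbTE jk) !mulr0.
  apply: (@eq_has_circle_cint (fun t => \sum_i \sum_(k < n) \sum_(j < n)
     (a i k * b i j)%:C * ((unit_circle t)^-1 ^+ k * unit_circle t ^+ j))).
    move=> t; apply: eq_bigr => i _; rewrite !seriesEord /= mulr_suml.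
    apply: eq_bigr => k _; rewrite mulr_sumr; apply: eq_bigr => j _.
    by rewrite rmorphM mulrACA.
  by do 3 (apply: has_circle_cint_sum => ?); exact: has_circle_cint_monomial.
have fM n t : `|f n t| <= \sum_i Ma i * Mb i.
  rewrite normrM [`|'i%C|]normc_def /= expr0n expr1n add0r sqrtr1 mul1r.
  apply: le_trans (ler_norm_sum _ _ _) _; apply: ler_sum => i _.
  rewrite normrM; apply: ler_pM => //; apply: norm_series_le => //.
    by rewrite normfV norm_unit_circle invr1.
  exact: norm_unit_circle.
have fF t : (fun n => f n t : R[i]^o) @ \oo --> (F t : R[i]^o).
  apply: cvgMl_tmp; apply: cvg_fsum => i; apply: cvgM.
    by apply: hA; exact: norm_unit_circle.
  by apply: hB; exact: norm_unit_circle.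
have cl : (c : nat -> R[i]^o) @ \oo --> ((2 * pi * \sum_i l i)%:C : R[i]^o).
  apply: cvg_ReIm => /=; last exact: cvg_cst.
  by apply: cvgMl_tmp; apply: cvg_fsum => i; exact: hl.
have icl : ((fun n => 'i%C * c n) : nat -> R[i]^o) @ \oo -->
    ('i%C * (2 * pi * \sum_i l i)%:C : R[i]^o) by exact: cvgMl_tmp cl.
have [hr hi] := circle_cint_limit fc fM fF icl.
have -> : circle_integral (fun z => (\sum_i A z i * B z i) * z^-1) =
    'i%C * (2 * pi * \sum_i l i)%:C.
  have cE (X : R[i]) : X = complex.Re X +i* complex.Im X by case: X.
  rewrite [RHS]cE -hr -hi.
  have E t : (\sum_i A (unit_circle t) i * B (unit_circle t) i) / unit_circle t *
      ('i%C * unit_circle t) = F t.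
    by rewrite mulrCA divfK ?unit_circle_neq0.
  by congr (_ +i* _); apply: eq_Rintegral => t _; rewrite -E.
clear -R.
have pi0 : pi%:C != 0 :> R[i] by rewrite (inj_eq (@complexI R)) gt_eqF // pi_gt0.
have i0 : 'i%C != 0 :> R[i] by rewrite eq_complex /= oner_eq0 andbF.
have -> : (2 * pi * \sum_i l i)%:C = 2 * pi%:C * (\sum_i l i)%:C :> R[i].
  by rewrite !rmorphM rmorph_nat.
move: ((\sum_i l i)%:C) (pi%:C) pi0 => y x x0.
by field; rewrite i0 x0.
Qed.

End Parseval.

(** * Square summable systems *)

Section SquareSummability.
Context {R : realType}.
Implicit Types (x y : nat -> R).

Lemma ell1M x y : ell1 x -> ell1 y -> ell1 (fun k => x k * y k).
Proof.
move=> [M xM] [L yL]; exists (M * L) => n.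
have L0 : 0 <= L by have := yL 0%N; rewrite big_ord0.
have yk k : `|y k| <= L.
  by apply: le_trans (yL k.+1); rewrite big_ord_recr /= lerDr sumr_ge0.
apply: (@le_trans _ _ ((\sum_(k < n) `|x k|) * L)).
  by rewrite mulr_suml; apply: ler_sum => k _; rewrite normrM ler_wpM2l.
by rewrite ler_wpM2r.
Qed.

Lemma ell1_sum n (f : 'I_n -> nat -> R) : (forall i, ell1 (f i)) ->
  ell1 (fun k => \sum_i f i k).
Proof.
elim: n f => [|n IH] f fi.
  by exists 0 => k; rewrite big1 // => j _; rewrite big_ord0 normr0.
apply: (@eq_ell1 _ (fun k => f ord0 k + \sum_(i < n) f (lift ord0 i) k)).
  by move=> k; rewrite big_ord_recl.
by apply: ell1D => //; apply: IH.
Qed.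

Definition l2_inner x y : R := limn (series (fun k => x k * y k)).

Lemma l2_innerC x y : l2_inner x y = l2_inner y x.
Proof.
rewrite /l2_inner; have -> // : (fun k => x k * y k) = (fun k => y k * x k).
by apply/funext => k; rewrite mulrC.
Qed.

Lemma cvg_l2_inner x y : ell1 x -> ell1 y ->
  series (fun k => x k * y k) @ \oo --> l2_inner x y.
Proof. by move=> hx hy; exact: (ell1_cvg (ell1M hx hy)). Qed.

Lemma cvg_mx_entrywise m n (A : nat -> 'M[R]_(m, n)) (L : 'M[R]_(m, n)) :
  (forall i j, (fun k => A k i j) @ \oo --> L i j) -> A @ \oo --> L.
Proof.
move=> AL; apply/cvgrPdist_le => e e0; near=> k.
rewrite /Num.Def.normr/= mx_normrE (bigmax_le _ (ltW e0))//= => i _.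
rewrite !mxE /=; move: i; near: k; apply: filter_forall => /= i.
by have /cvgrPdist_le := AL i.1 i.2; exact.
Unshelve. all: by end_near. Qed.

Context {m r : nat}.
Implicit Types (s : nat -> 'M[R]_(m, r)).

Definition entrywise_ell1 s := forall a b, ell1 (fun k => s k a b).

Lemma sys_innerE s1 s2 : entrywise_ell1 s1 -> entrywise_ell1 s2 ->
  sys_inner s1 s2 = \sum_a \sum_b l2_inner (fun k => s1 k a b) (fun k => s2 k a b).
Proof.
move=> h1 h2.
pose L : 'M[R]_m := \matrix_(a, a')
  \sum_b l2_inner (fun k => s1 k a b) (fun k => s2 k a' b).
have cL : series (fun k => s1 k *m (s2 k)^T) @ \oo --> L.
  apply: cvg_mx_entrywise => a a'; rewrite mxE.
  have -> : (fun k => series (fun k => s1 k *m (s2 k)^T) k a a') =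
      (fun n => \sum_b series (fun k => s1 k a b * s2 k a' b) n).
    apply/funext => n; rewrite seriesEord /= summxE.
    under [RHS]eq_bigr do rewrite seriesEord /=.
    rewrite exchange_big; apply: eq_bigr => k _; rewrite mxE.
    by apply: eq_bigr => b _; rewrite mxE.
  by apply: cvg_fsum => b; exact: cvg_l2_inner.
rewrite /sys_inner (cvg_lim _ cL) //; apply: eq_bigr => a _.
by rewrite mxE.
Qed.

Lemma square_summable_ell1 s : entrywise_ell1 s -> square_summable s.
Proof.
move=> h; apply/cvg_ex; exists (\sum_a \sum_b l2_inner (fun k => s k a b) (fun k => s k a b)).
have -> : series (fun k => \tr (s k *m (s k)^T)) =
    (fun n => \sum_a \sum_b series (fun k => s k a b * s k a b) n).
  apply/funext => n; rewrite seriesEord /=.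
  under [RHS]eq_bigr do (under eq_bigr do rewrite seriesEord /=).
  under [RHS]eq_bigr do rewrite exchange_big.
  rewrite [RHS]exchange_big; apply: eq_bigr => k _.
  apply: eq_bigr => a _; rewrite mxE.
  by apply: eq_bigr => b _; rewrite mxE.
by apply: cvg_fsum => a; apply: cvg_fsum => b; exact: cvg_l2_inner.
Qed.

End SquareSummability.

(** * Coordinate lines are smooth curves *)

Section Lines.
Context {R : realType} {W : normedModType R}.
Implicit Types (A : set R) (a w : W).

Lemma Ck_on_cst n A a : Ck_on (V := R^o) n A (cst a).
Proof.
elim: n a => [|n IH] a /=; first by move=> x _; exact: cst_continuous.
split=> [x _|v]; first exact: differentiable_cst.
have -> : (fun x : R^o => 'D_v (cst a) x) = cst (0 : W).
  by apply/funext => x; rewrite derive_cst.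
exact: IH.
Qed.

Definition line a w (s : R) : W := a + s *: w.

Lemma differentiable_line a w (x : R) : differentiable (line a w : R^o -> W) x.
Proof.
apply: differentiableD; first exact: differentiable_cst.
by apply: differentiableZl; apply: ex_diff.
Qed.

Lemma derive_line a w (x v : R) : 'D_v (line a w : R^o -> W) x = v *: w.
Proof.
apply: cvg_lim => //.
have -> : (fun h => h^-1 *: ((line a w \o shift x) (h *: v) - line a w x)) =
   (fun h => (h^-1 * h) *: (v *: w)).
  apply/funext => h; rewrite /line /= scalerDl opprD addrACA subrr add0r addrK.
  by rewrite -scalerA; congr (_ *: _); rewrite scalerA.
apply: cvg_near_cst; near=> s.
by rewrite mulVf ?scale1r //; near: s; exact: nbhs_dnbhs_neq.
Unshelve. all: by end_near. Qed.

Lemma Ck_on_line n A a w : Ck_on (V := R^o) n A (line a w).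
Proof.
case: n => [|n] /=.
  by move=> x _; apply: differentiable_continuous; exact: differentiable_line.
split=> [x _|v]; first exact: differentiable_line.
have -> : (fun x : R^o => 'D_v (line a w) x) = cst (v *: w).
  by apply/funext => x; rewrite derive_line.
exact: Ck_on_cst.
Qed.

End Lines.

(** * The metric tensor in local coordinates *)

Section MetricTensor.
Context {R : realType} {d m r : nat}.
Variables (U : set 'rV[R]_d) (h : 'rV[R]_d -> nat -> 'M[R]_(m, r)).
Variables (N D : 'rV[R]_d -> 'M[{poly R}]_(m, r)).
Hypothesis hcoord : local_coordinates U h N D.
Variable theta : 'rV[R]_d.
Hypothesis htheta : U theta.

Let size_bound : exists n, forall t a b, U t ->
  (size (N t a b) <= n.+1)%N /\ (size (D t a b) <= n.+1)%N.
Proof.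
have [_ _ _ _ [[n hn] _ _ _]] := hcoord; exists n => t a b /(hn t a b) [sN sD].
by split; [apply: leq_trans sN _ | apply: leq_trans sD _].
Qed.

Let near_family : exists n, forall a b, \forall t \near theta,
  [/\ (size (N t a b) <= n.+1)%N, (size (D t a b) <= n.+1)%N, D t a b != 0,
      disc_roots (D t a b) & expansion (fun k => h t k a b) (N t a b) (D t a b)].
Proof.
have [n hn] := size_bound; exists n => a b.
have [oU _ htf hst [_ _ _ hcz]] := hcoord.
have : \forall t \near theta, U t by exact: open_nbhs_nbhs.
apply: filterS => t Ut; have [sN sD] := hn t a b Ut.
have [hD [rho hrho]] := htf t Ut; split => //.
  apply: disc_roots_of_stable => z; first exact: hst.
  exact: hcz.
by exists rho => z hz; have := hrho z a b hz; rewrite /tf_eval mxE.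
Qed.

Let differentiable_N a b j : differentiable (fun t => (N t a b)`_j) theta.
Proof. by have [_ _ _ _ [_ sN _ _]] := hcoord; have [+ _] := sN a b j 1%N; exact. Qed.

Let differentiable_D a b j : differentiable (fun t => (D t a b)`_j) theta.
Proof. by have [_ _ _ _ [_ _ sD _]] := hcoord; have [+ _] := sD a b j 1%N; exact. Qed.

(** The tangent system of the [i]-th coordinate line. *)
Definition coord_tangent (i : 'I_d) k : 'M[R]_(m, r) :=
  \matrix_(a, b) 'D_(delta_mx 0 i) (fun t => h t k a b) theta.

Lemma differentiable_h k a b : differentiable (fun t => h t k a b) theta.
Proof.
have [n fam] := near_family.
exact: (differentiable_markov (fam a b) (differentiable_N a b) (differentiable_D a b)).
Qed.

Lemma ell1_coord_tangent i : entrywise_ell1 (coord_tangent i).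
Proof.
move=> a b; have [n fam] := near_family.
apply: eq_ell1 (ell1_dmarkov (fam a b) (differentiable_N a b) (differentiable_D a b)
  (delta_mx 0 i)) => k.
by rewrite mxE.
Qed.

Lemma pow_sum_coord_tangent i a b (z : R[i]) : `|z| = 1 ->
  pow_sum (fun k => (coord_tangent i k a b)%:C) z^-1
    (partial i (fun t => tf_eval (N t) (D t) z) theta a b).
Proof.
move=> z1; have [n fam] := near_family.
have := pow_sum_partial (fam a b) (differentiable_N a b) (differentiable_D a b)
  (v := delta_mx 0 i) z1.
rewrite mxE; under [in X in _ -> pow_sum _ _ (X +i* _)]eq_fun do rewrite mxE.
under [in X in _ -> pow_sum _ _ (_ +i* X)]eq_fun do rewrite mxE.
by apply: eq_pow_sum => k; rewrite mxE.
Qed.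

(** The chain rule at theta, for each Markov parameter separately. *)
Lemma tangent_systemE c v k a b : smooth_curve_through U theta c v ->
  tangent_system h c v k a b = \sum_i derive1 c v 0 i * coord_tangent i k a b.
Proof.
move=> [cv [e e0 [sc _]]].
have dc : differentiable (c : R^o -> 'rV[R]_d) v.
  by have [+ _] := sc 1%N; apply; exact: ballxx.
have dhc a' b' : differentiable ((fun t => h t k a' b') \o c : R^o -> R) v.
  by apply: differentiable_comp => //; rewrite cv; exact: differentiable_h.
rewrite /tangent_system derive1E derive_mx; last first.
  by apply/derivable_mxP => a' b'; apply: diff_derivable; exact: dhc.
rewrite mxE.
rewrite (_ : (fun t => h (c t) k a b) = (fun t => h t k a b) \o c) //.
rewrite deriveE // diff_comp //; last by rewrite cv; exact: differentiable_h.
rewrite /= -(deriveE _ dc) -derive1E cv {1}(row_sum_delta (derive1 c v)) linear_sum.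
apply: eq_bigr => i _; rewrite linearZ !mxE -deriveE //.
exact: differentiable_h.
Qed.

Definition coord_metric : 'M[R]_d := \matrix_(i, j)
  \sum_a \sum_b l2_inner (fun k => coord_tangent i k a b) (fun k => coord_tangent j k a b).

Lemma ell1_tangent_system c v : smooth_curve_through U theta c v ->
  entrywise_ell1 (tangent_system h c v).
Proof.
move=> sc a b.
apply: (@eq_ell1 _ (fun k => \sum_i derive1 c v 0 i * coord_tangent i k a b)).
  by move=> k; rewrite tangent_systemE.
by apply: ell1_sum => i; apply: ell1Z; exact: ell1_coord_tangent.
Qed.

Lemma sys_inner_tangent c1 v1 c2 v2 :
  smooth_curve_through U theta c1 v1 -> smooth_curve_through U theta c2 v2 ->
  (derive1 c1 v1 *m coord_metric *m (derive1 c2 v2)^T) 0 0 =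
    sys_inner (tangent_system h c1 v1) (tangent_system h c2 v2).
Proof.
move=> s1 s2; rewrite sys_innerE; [|exact: ell1_tangent_system..].
set w1 := derive1 c1 v1; set w2 := derive1 c2 v2.
have E a b : l2_inner (fun k => tangent_system h c1 v1 k a b)
                      (fun k => tangent_system h c2 v2 k a b) =
  \sum_j \sum_i w1 0 i * w2 0 j *
    l2_inner (fun k => coord_tangent i k a b) (fun k => coord_tangent j k a b).
  apply: cvg_lim => //.
  rewrite (_ : series _ = (fun n => \sum_j \sum_i w1 0 i * w2 0 j *
     series (fun k => coord_tangent i k a b * coord_tangent j k a b) n)); last first.
    apply/funext => n; rewrite seriesEord /=.
    under [RHS]eq_bigr do (under eq_bigr do rewrite seriesEord /= mulr_sumr).
    under [RHS]eq_bigr do rewrite exchange_big.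
    rewrite [RHS]exchange_big; apply: eq_bigr => k _.
    rewrite !tangent_systemE // mulr_sumr; apply: eq_bigr => j _.
    by rewrite mulr_suml; apply: eq_bigr => i _; exact: mulrACA.
  apply: cvg_fsum => j; apply: cvg_fsum => i; apply: cvgMl_tmp.
  by apply: cvg_l2_inner; exact: ell1_coord_tangent.
under [RHS]eq_bigr do (under eq_bigr do rewrite E).
rewrite mxE.
under [RHS]eq_bigr do rewrite exchange_big.
rewrite [RHS]exchange_big; apply: eq_bigr => j _; rewrite !mxE mulr_suml.
under [RHS]eq_bigr do rewrite exchange_big.
rewrite [RHS]exchange_big; apply: eq_bigr => i _; rewrite !mxE.
rewrite mulrAC mulr_sumr; apply: eq_bigr => a _.
by rewrite mulr_sumr.
Qed.

Lemma coord_metricP : is_metric_tensor U h theta coord_metric.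
Proof.
split.
  apply/matrixP => i j; rewrite !mxE; apply: eq_bigr => a _; apply: eq_bigr => b _.
  exact: l2_innerC.
move=> c1 v1 c2 v2 s1 s2; split; last exact: sys_inner_tangent.
  by apply: square_summable_ell1; exact: ell1_tangent_system.
by apply: square_summable_ell1; exact: ell1_tangent_system.
Qed.

Lemma coord_line_smooth i : smooth_curve_through U theta (line theta (delta_mx 0 i)) 0.
Proof.
split; first by rewrite /line scale0r addr0.
have [oU _ _ _ _] := hcoord.
have cl : {for 0, continuous (line theta (delta_mx 0 i) : R^o -> 'rV[R]_d)}.
  by apply: differentiable_continuous; exact: differentiable_line.
have /cl /nbhs_ballP [e e0 he] : nbhs (line theta (delta_mx 0 i) 0) U.
  by rewrite /line scale0r addr0; exact: open_nbhs_nbhs.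
exists e => //; split; first by move=> n; exact: Ck_on_line.
by move=> t /he.
Qed.

(** The velocities of the coordinate lines are the standard basis vectors, so
    the defining identity on pairs of such lines reads off every entry. *)
Lemma metric_tensor_unique G : is_metric_tensor U h theta G -> G = coord_metric.
Proof.
move=> [_ hG]; apply/matrixP => i j.
have entry (K : 'M[R]_d) : K i j = (derive1 (line theta (delta_mx 0 i)) 0 *m K *m
    (derive1 (line theta (delta_mx 0 j)) 0)^T) 0 0.
  by rewrite !derive1E !derive_line !scale1r -rowE trmx_delta -colE !mxE.
rewrite !entry sys_inner_tangent; [|exact: coord_line_smooth..].
by have [_ _ ->] := hG _ _ _ _ (coord_line_smooth i) (coord_line_smooth j).
Qed.

Lemma coord_metric_contour i j : (coord_metric i j)%:C =
  (2 * pi%:C * 'i%C)^-1 *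
  circle_integral (fun z =>
    \tr (partial i (fun t => tf_eval (N t) (D t) z) theta *m
         partial j (fun t => (tf_eval (N t) (D t) z^-1)^T) theta) * z^-1).
Proof.
pose A z (s : 'I_m * 'I_r) := partial i (fun t => tf_eval (N t) (D t) z) theta s.1 s.2.
pose B z (s : 'I_m * 'I_r) := partial j (fun t => tf_eval (N t) (D t) z^-1) theta s.1 s.2.
have -> : (fun z => \tr (partial i (fun t => tf_eval (N t) (D t) z) theta *m
      partial j (fun t => (tf_eval (N t) (D t) z^-1)^T) theta) * z^-1) =
    (fun z => (\sum_s A z s * B z s) * z^-1).
  apply/funext => z; congr (_ * _); rewrite -(pair_bigA _ (fun a b => A z (a, b) * B z (a, b))).
  apply: eq_bigr => a _; rewrite mxE; apply: eq_bigr => b _; congr (_ * _).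
  rewrite /B !mxE /=; congr (_ +i* _).
    by under eq_fun do rewrite mxE.
  by under eq_fun do rewrite mxE.
pose x i (s : 'I_m * 'I_r) k := coord_tangent i k s.1 s.2.
rewrite (@circle_integral_parseval _ _ (x i) (x j) A B (fun s => l2_inner (x i s) (x j s))).
- by rewrite mxE pair_bigA.
- by move=> s; exact: ell1_coord_tangent.
- by move=> s; exact: ell1_coord_tangent.
- by move=> s z z1; exact: pow_sum_coord_tangent.
- move=> s z z1; rewrite -[X in pow_sum _ X _]invrK.
  by apply: pow_sum_coord_tangent; rewrite normfV z1 invr1.
- by move=> s; apply: cvg_l2_inner; exact: ell1_coord_tangent.
Qed.

End MetricTensor.

Theorem theorem4 (R : realType) (d m r : nat) (U : set 'rV[R]_d)
    (h : 'rV[R]_d -> nat -> 'M[R]_(m, r))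
    (N D : 'rV[R]_d -> 'M[{poly R}]_(m, r))
    (hcoord : local_coordinates U h N D)
    (theta : 'rV[R]_d) (htheta : U theta) :
  (exists! G : 'M[R]_d, is_metric_tensor U h theta G) /\
  forall G : 'M[R]_d, is_metric_tensor U h theta G ->
    forall i j : 'I_d,
      (G i j)%:C =
      (2 * pi%:C * 'i%C)^-1 *
      circle_integral (fun z =>
        \tr (partial i (fun t => tf_eval (N t) (D t) z) theta *m
             partial j (fun t => (tf_eval (N t) (D t) z^-1)^T) theta) * z^-1).
Proof.
split.
  exists (coord_metric h theta); split.
    exact: (coord_metricP hcoord htheta).
  by move=> G hG; rewrite (metric_tensor_unique hcoord htheta hG).
move=> G hG i j; rewrite (metric_tensor_unique hcoord htheta hG).
exact: (coord_metric_contour hcoord htheta).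
Qed.
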